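(* Let $m>5$ be an integer, let $r=2^m-1$, and let $X\subset\mathbb{P}^r$ be the product $(\mathbb{P}^1)^m$ of $m$ copies of $\mathbb{P}^1$ over $\mathbb{C}$, embedded in $\mathbb{P}^r$ by the standard Segre embedding. Let $k\ge 0$ be an integer and let $S^k(X)$ be the $k$-th secant variety of $X$, generated by the $(k+1)$-secant $k$-spaces. If $k+1\leq 2^{m-1}/m$, then a general point of $S^k(X)$ is contained in only one $(k+1)$-secant $k$-space of $X$.
   Context: All varieties are over $\mathbb{C}$. A $(k+1)$-secant $k$-space of $X\subset\mathbb{P}^r$ is a $k$-dimensional linear subspace of $\mathbb{P}^r$ spanned by $k+1$ linearly independent points of $X$. The $k$-th secant variety $S^k(X)$ is the Zariski closure in $\mathbb{P}^r$ of the union of all $(k+1)$-secant $k$-spaces of $X$. More precisely, the conclusion is that $X$ is $k$-identifiable: for a general point $P\in S^k(X)$ there is a unique unordered $(k+1)$-tuple $P_0,\dots,P_k$ of points of $X$ such that $P\in\langle P_0,\dots,P_k\rangle$, where $\langle\cdot\rangle$ denotes linear span. ''General'' means: outside some proper Zariski closed subset. *)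

(* Defs.v *)
From HB Require Import structures.
From mathcomp Require Import all_boot all_order all_algebra.
From mathcomp Require Import boolp classical_sets reals.
From mathcomp Require Import complex.
From mathcomp Require Import mpoly.

Set Implicit Arguments.
Unset Strict Implicit.
Unset Printing Implicit Defensive.

Import GRing.Theory.
Local Open Scope ring_scope.
Local Open Scope classical_set_scope.

(* The points of P^r are the lines through the origin in F^(r+1), and more
   generally a k-dimensional linear subspace of P^r is a subspace of F^(r+1) of
   dimension k+1; incidence is inclusion of subspaces. *)
Record point (F : fieldType) (r : nat) := Point {
  line :> {vspace 'rV[F]_r.+1};
  dim_line : \dim line == 1%N
}.

HB.instance Definition _ (F : fieldType) (r : nat) :=
  [isSub for @line F r].
HB.instance Definition _ (F : fieldType) (r : nat) :=
  [Choice of point F r by <:].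

(* A vector of homogeneous coordinates of P. *)
Definition hcoord (F : fieldType) r (P : point F r) : 'rV[F]_r.+1 := vpick P.

Lemma hcoord_neq0 (F : fieldType) r (P : point F r) : hcoord P != 0.
Proof. by rewrite vpick0 -dimv_eq0 (eqP (dim_line P)). Qed.

Lemma line_hcoord (F : fieldType) r (P : point F r) : line P = <[hcoord P]>%VS.
Proof.
apply/esym/eqP; rewrite eqEdim -memvE memv_pick /=.
by rewrite (eqP (dim_line P)) dim_vline hcoord_neq0.
Qed.

Definition point_of (F : fieldType) r (v : 'rV[F]_r.+1) (v_neq0 : v != 0) :
    point F r :=
  @Point F r <[v]>%VS (introT eqP (etrans (dim_vline v) (congr1 nat_of_bool v_neq0))).

(* The zero locus in P^r of a set of polynomials, to be used for homogeneous
   ones: p vanishes at P when it vanishes at every vector of the line P. *)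
Definition zero_locus (F : fieldType) r (I : set {mpoly F[r.+1]}) :
    set (point F r) :=
  [set P | forall p, I p -> forall v, v \in line P -> p.@[v 0] = 0].

Definition zariski_closed (F : fieldType) r (Z : set (point F r)) : Prop :=
  exists I : set {mpoly F[r.+1]},
    (forall p, I p -> exists d, p \is d.-homog) /\ Z = zero_locus I.

Definition zariski_closure (F : fieldType) r (A : set (point F r)) :
    set (point F r) :=
  [set P | forall Z, zariski_closed Z -> A `<=` Z -> Z P].

Definition general (F : fieldType) r (S : set (point F r))
    (Q : point F r -> Prop) : Prop :=
  exists Z, [/\ zariski_closed Z, Z `<` S & forall P, S P -> ~ Z P -> Q P].

Definition linear_span (F : fieldType) r n (s : n.-tuple (point F r)) :
    {vspace 'rV[F]_r.+1} :=
  (\sum_(i < n) tnth s i)%VS.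

Definition lin_indep (F : fieldType) r n (s : n.-tuple (point F r)) : Prop :=
  directv (\sum_(i < n) tnth s i).

Definition secant_space (F : fieldType) r (X : set (point F r)) (k : nat)
    (L : {vspace 'rV[F]_r.+1}) : Prop :=
  \dim L = k.+1 /\
  exists s : k.+1.-tuple (point F r),
    [/\ forall i, X (tnth s i), lin_indep s & L = linear_span s].

Definition secant_variety (F : fieldType) r (X : set (point F r)) (k : nat) :
    set (point F r) :=
  zariski_closure
    [set P | exists2 L, secant_space X k L & (line P <= L)%VS].

Definition decomposition (F : fieldType) r (X : set (point F r)) n
    (P : point F r) (s : n.-tuple (point F r)) : Prop :=
  (forall i, X (tnth s i)) /\ (line P <= linear_span s)%VS.

(* Unordered tuples are tuples up to permutation; repetitions are allowed. *)
Definition unique_decomposition (F : fieldType) r (X : set (point F r))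
    (n : nat) (P : point F r) : Prop :=
  exists2 s : n.-tuple (point F r),
    decomposition X P s &
    forall t : n.-tuple (point F r), decomposition X P t -> perm_eq s t.

(* The i-th binary digit of j, as an index of the coordinates of P^1. *)
Definition bit (i j : nat) : 'I_2 := inord (odd (j %/ 2 ^ i)).

(* The homogeneous coordinates of P^(2^m - 1), numbered from 0 to 2^m - 1, are
   matched through binary expansion with the 2^m multilinear monomials obtained
   by choosing one of the two coordinates in each factor P^1. *)
Definition segre_vec (F : fieldType) m (v : 'I_m -> 'rV[F]_2) :
    'rV[F]_(2 ^ m - 1).+1 :=
  \row_j \prod_(i < m) v i 0 (bit i j).

Lemma bit_surj m (b : nat -> bool) :
  exists2 j : nat, (j < 2 ^ m)%N & forall i, (i < m)%N -> bit i j = inord (b i).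
Proof.
elim: m b => [|m IHm] b; first by exists 0%N.
have [j ltj jb] := IHm (b \o succn).
exists (b 0%N + j.*2)%N.
  by rewrite expnS mul2n -ltn_half_double half_bit_double.
move=> [|i] lti; first by rewrite /bit divn1 oddD odd_double addbF oddb.
by rewrite -jb // /bit expnS divnMA divn2 half_bit_double.
Qed.

Lemma segre_vec_neq0 (F : fieldType) m (v : 'I_m -> 'rV[F]_2) :
  (forall i, v i != 0) -> segre_vec v != 0.
Proof.
move=> v_neq0.
have nz i : exists b : bool, v i 0 (inord b) != 0.
  have /rV0Pn[c vc] := v_neq0 i.
  exists (c == 1); suff -> : inord (c == 1) = c by [].
  by apply: val_inj; rewrite /= inordK; case: c {vc} => [[|[|]]].
have [f fP] := choice nz.
pose b (n : nat) := if insub n is Some i then f i else false.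
have [j ltj jb] := bit_surj m b.
have ltj' : (j < (2 ^ m - 1).+1)%N by rewrite subn1 prednK // expn_gt0.
apply/rV0Pn; exists (Ordinal ltj'); rewrite mxE; apply/prodf_neq0 => i _.
by rewrite jb //= /b valK.
Qed.

Definition segre (F : fieldType) m (x : {ffun 'I_m -> point F 1}) :
    point F (2 ^ m - 1) :=
  point_of (segre_vec_neq0 (fun i => hcoord_neq0 (x i))).

(* The embedding does not depend on the choice of homogeneous coordinates. *)
Lemma line_segre (F : fieldType) m (x : {ffun 'I_m -> point F 1})
    (v : 'I_m -> 'rV[F]_2) :
  (forall i, line (x i) = <[v i]>%VS) -> line (segre x) = <[segre_vec v]>%VS.
Proof.
move=> xv.
have v_neq0 i : v i != 0.
  by have := dim_line (x i); rewrite xv dim_vline eqb1.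
have nz i : exists c, hcoord (x i) = c *: v i.
  by apply/vlineP; rewrite -xv memv_pick.
have [c cP] := choice nz.
have segreE : segre_vec (fun i => hcoord (x i)) = (\prod_i c i) *: segre_vec v.
  apply/rowP => j; rewrite !mxE -big_split /=.
  by apply: eq_bigr => i _; rewrite cP mxE.
apply/eqP; rewrite eqEdim -memvE [line _]/= segreE memvZ ?memv_line //=.
rewrite -segreE !dim_vline !segre_vec_neq0 // => i; exact: hcoord_neq0.
Qed.

Definition segre_variety (F : fieldType) m : set (point F (2 ^ m - 1)) :=
  range (@segre F m).

(* Main.v *)
Require Import Defs.
From mathcomp Require Import all_boot all_order all_algebra.
From mathcomp Require Import boolp classical_sets reals.
From mathcomp Require Import complex.
From mathcomp Require Import closed_field mpoly ring zify fintype finset.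

(* Write the tensors as T = sum_j w_j (x) b_j with n = k + 1 terms, where w_j lies in the Segre
   variety of m - 1 factors and b_j in F^2. Let T be a general such tensor, and let
   T = sum_l w'_l (x) b'_l be any other decomposition. Moving b'_l shows that w'_l (x) F^2 lies in
   the tangent space at T of the closure of the set of these tensors, which for general T is the
   sum of the tangent spaces to the Segre cone at the points w_j (x) b_j. Contracting with the
   equation of b_j, and using that the tangent spaces at n - 1 general points and one more general
   point of the Segre variety of m - 1 factors are independent, one finds that w'_l lies in
   M_j = T_(w_j) + <w_1, ..., w_n> for each j. Since two of the M_j meet in <w_1, ..., w_n>, this
   space contains all the w'_l. As n <= 2^(m-2), splitting off another factor shows that a point of
   the Segre variety in <w_1, ..., w_n> is one of the w_j, so that the two decompositions agree.

   The independence of the tangent spaces at N general points of (P^1)^s, needed only for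
   (N + 1)(s + 1) <= 2^s, follows by induction on s on putting half of the points on each of two
   parallel hyperplanes; the slack of s + 1 is what makes this work for odd N. *)

Set Implicit Arguments.
Unset Strict Implicit.
Unset Printing Implicit Defensive.

Import Order.TTheory GRing.Theory Num.Theory.
Import Defs.
Local Open Scope ring_scope.

(** * Polynomials in characteristic zero *)

Section Polynomials.
Variable F : numFieldType.

(** The integers 1, ..., [size q] are distinct and nonzero in characteristic zero, and there are
    more of them than [q] can have roots. *)
Lemma poly_nonroot (q : {poly F}) : q != 0 -> exists2 t, t != 0 & q.[t] != 0.
Proof.
move=> q_neq0; pose s : seq F := [seq i.+1%:R | i <- iota 0 (size q)].
have us : uniq s.
  by rewrite map_inj_uniq ?iota_uniq // => i j /eqP; rewrite eqr_nat => /eqP[].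
have [/allP all_root|] := boolP (all (root q) s).
  have := max_poly_roots q_neq0 (introT allP all_root) us.
  by rewrite size_map size_iota ltnn.
by case/allPn=> t /mapP[i _ ->] nr; exists i.+1%:R; rewrite ?pnatr_eq0.
Qed.

Lemma poly_eq0 (q : {poly F}) : (forall t, t != 0 -> q.[t] = 0) -> q = 0.
Proof.
move=> q0; apply/eqP/contraT => /poly_nonroot[t t_neq0].
by rewrite q0 ?eqxx.
Qed.

Lemma mpoly_ring_ind n (P : {mpoly F[n]} -> Prop) :
    (forall c, P c%:MP) -> (forall i, P 'X_i) ->
    (forall p q, P p -> P q -> P (p + q)) ->
    (forall p q, P p -> P q -> P (p * q)) ->
  forall p, P p.
Proof.
move=> PC PX PD PM; have P0 : P 0 by rewrite -mpolyC0.
have P1 : P 1 by rewrite -mpolyC1.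
move=> p; elim/mpolyind: p => // c m p _ _ Pp; apply: PD Pp.
rewrite -mul_mpolyC; apply: (PM) => //; rewrite mpolyXE_id.
apply: (@big_ind _ P _ _ P1 PM) => i _.
elim: (m i) => [|k IHk]; first by rewrite expr0.
by rewrite exprS; apply: PM.
Qed.

(** The chain rule along a line. It is compatible with sums and products, so it only has to be
    checked on constants and variables. *)
Lemma meval_line n (p : {mpoly F[n]}) (x y : 'I_n -> F) :
  exists2 q : {poly F}, forall t, p.@[fun i => x i + t * y i] = q.[t] &
    q^`().[0] = \sum_i p^`M(i).@[x] * y i.
Proof.
move: p; apply: mpoly_ring_ind => [c|i|p1 p2 [q1 E1 D1] [q2 E2 D2]|p1 p2 [q1 E1 D1] [q2 E2 D2]].
- exists c%:P => [t|]; first by rewrite mevalC hornerC.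
  rewrite derivC horner0 big1 // => i _.
  by rewrite mderivC meval0 mul0r.
- exists ((x i)%:P + y i *: 'X) => [t|]; first by rewrite mevalXU !hornerE mulrC.
  rewrite derivD derivC derivZ derivX !hornerE (bigD1 i) //= big1 ?addr0.
    rewrite mderivX mnmE eqxx scale1r.
    have -> : (U_(i) - U_(i))%MM = 0%MM :> 'X_{1..n} by apply/mnmP => j; rewrite mnmBE mnm0E subnn.
    by rewrite mpolyX0 meval1 mul1r.
  move=> j ne_ji; rewrite mderivX mnmE eq_sym (negPf ne_ji).
  by rewrite scale0r meval0 mul0r.
- exists (q1 + q2) => [t|]; first by rewrite mevalD E1 E2 hornerD.
  rewrite derivD hornerD D1 D2 -big_split; apply: eq_bigr => i _.
  by rewrite mderivD mevalD mulrDl.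
exists (q1 * q2) => [t|]; first by rewrite mevalM E1 E2 hornerM.
have x0 p : p.@[x] = p.@[fun i => x i + 0 * y i].
  by apply: meval_eq => i; rewrite mul0r addr0.
rewrite derivM hornerD !hornerM D1 D2 mulr_suml mulr_sumr -big_split.
apply: eq_bigr => i _; rewrite mderivM mevalD !mevalM -E1 -E2 -!x0 /=; ring.
Qed.

Lemma msize_mderiv n (p : {mpoly F[n]}) i : p != 0 -> (msize p^`M(i) < msize p)%N.
Proof.
move=> p_neq0; rewrite (mpolySpred _ p_neq0) ltnS msizeE.
apply/bigmax_leqP_seq => m; rewrite mcoeff_msupp mcoeff_mderiv => nz _.
have /msize_mdeg_lt : (m + U_(i))%MM \in msupp p.
  by rewrite mcoeff_msupp; apply: contraNneq nz => ->; rewrite mul0rn.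
by rewrite mdegD mdeg1 addn1 (mpolySpred _ p_neq0).
Qed.

(** Up to a positive integer factor, each nonconstant coefficient of [p] is a coefficient of some
    partial derivative. *)
Lemma mderiv_eq0 n (p : {mpoly F[n]}) : (forall i, p^`M(i) = 0) -> p = (p@_0)%:MP.
Proof.
move=> dp0; apply/mpolyP => m; rewrite mcoeffC.
have [->|m_neq0] := eqVneq m 0%MM; first by rewrite mulr1.
have /existsP[i mi] : [exists i, m i != 0%N].
  apply: contraNT m_neq0 => /existsPn m0; apply/eqP/mnmP => i.
  by rewrite mnm0E; apply/eqP; have := m0 i; rewrite negbK.
have := congr1 (mcoeff (m - U_(i))) (dp0 i).
rewrite mcoeff_mderiv mcoeff0 submK; last by rewrite lep1mP.
by move/eqP; rewrite mulrn_eq0 /= => /eqP->; rewrite mulr0.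
Qed.

End Polynomials.

(** * Polynomial functions and generic properties *)

Section PolynomialFunctions.
Variables (F : numFieldType) (V : finType).
Implicit Types (f g : (V -> F) -> F) (P Q : (V -> F) -> Prop).

(** Indexing the variables by a finite type allows parameters that are pairs, such as a point and
    one of its coordinates. *)
Definition polyfun f : Prop :=
  exists p : {mpoly F[#|V|]}, forall x, f x = p.@[fun i => x (enum_val i)].

Lemma polyfun_cst c : polyfun (fun=> c).
Proof. by exists c%:MP => x; rewrite mevalC. Qed.

Lemma polyfun_var v : polyfun (fun x => x v).
Proof. by exists 'X_(enum_rank v) => x; rewrite mevalXU enum_rankK. Qed.

Lemma polyfunD f g : polyfun f -> polyfun g -> polyfun (fun x => f x + g x).
Proof. by move=> [p fp] [q gq]; exists (p + q) => x; rewrite mevalD fp gq. Qed.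

Lemma polyfunM f g : polyfun f -> polyfun g -> polyfun (fun x => f x * g x).
Proof. by move=> [p fp] [q gq]; exists (p * q) => x; rewrite mevalM fp gq. Qed.

Lemma polyfun_sum I (r : seq I) (C : pred I) (f : I -> (V -> F) -> F) :
  (forall i, polyfun (f i)) -> polyfun (fun x => \sum_(i <- r | C i) f i x).
Proof.
move=> fP; elim: r => [|i r IHr].
  by under eq_fun do rewrite big_nil; apply: polyfun_cst.
under eq_fun do rewrite big_cons; case: (C i) => //.
by apply: polyfunD.
Qed.

Lemma polyfun_prod I (r : seq I) (C : pred I) (f : I -> (V -> F) -> F) :
  (forall i, polyfun (f i)) -> polyfun (fun x => \prod_(i <- r | C i) f i x).
Proof.
move=> fP; elim: r => [|i r IHr].
  by under eq_fun do rewrite big_nil; apply: polyfun_cst.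
under eq_fun do rewrite big_cons; case: (C i) => //.
by apply: polyfunM.
Qed.

Lemma polyfun_meval n (p : {mpoly F[n]}) (f : 'I_n -> (V -> F) -> F) :
  (forall i, polyfun (f i)) -> polyfun (fun x => p.@[fun i => f i x]).
Proof.
move=> fP; move: p; apply: mpoly_ring_ind => [c|i|p q pP qP|p q pP qP].
- by under eq_fun do rewrite mevalC; apply: polyfun_cst.
- by under eq_fun do rewrite mevalXU.
- by under eq_fun do rewrite mevalD; apply: polyfunD.
- by under eq_fun do rewrite mevalM; apply: polyfunM.
Qed.

Lemma polyfun_det n (f : 'I_n -> 'I_n -> (V -> F) -> F) :
  (forall i j, polyfun (f i j)) -> polyfun (fun x => \det (\matrix_(i, j) f i j x)).
Proof.
move=> fP; apply: polyfun_sum => s; apply: polyfunM; first exact: polyfun_cst.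
by apply: polyfun_prod => i; under eq_fun do rewrite mxE.
Qed.

Lemma polyfun_line f x y : polyfun f ->
  exists q : {poly F}, forall t, f (fun v => x v + t * y v) = q.[t].
Proof.
case=> p fp; have [q qE _] := meval_line p (x \o enum_val) (y \o enum_val).
by exists q => t; rewrite fp -qE.
Qed.

(** Affine space is irreducible: on the line through a point where [f] is nonzero and one where [g]
    is nonzero, both restrict to nonzero polynomials in one variable. *)
Lemma polyfun_neq0 f g : polyfun f -> polyfun g ->
  (exists x, f x != 0) -> (exists x, g x != 0) -> exists x, f x * g x != 0.
Proof.
move=> fP gP [x fx] [y gy]; pose z v := y v - x v.
have [p pE] := polyfun_line x z fP; have [q qE] := polyfun_line x z gP.
have /poly_nonroot[t _] : p * q != 0.
  rewrite mulf_neq0 //.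
    apply: contraNneq fx => p0; have := pE 0; rewrite p0 horner0 => <-; apply/eqP.
    by congr f; apply/funext => v; rewrite mul0r addr0.
  apply: contraNneq gy => q0; have := qE 1; rewrite q0 horner0 => <-; apply/eqP.
  by congr g; apply/funext => v; rewrite mul1r addrC subrK.
by rewrite hornerM -pE -qE; exists (fun v => x v + t * z v).
Qed.

(** [P] has to contain a nonempty principal open subset of affine space but need not be open
    itself. *)
Definition generic P : Prop :=
  exists2 f, polyfun f & (exists x, f x != 0) /\ forall x, f x != 0 -> P x.

Lemma generic_ex P : generic P -> exists x, P x.
Proof. by case=> f _ [[x fx] fP]; exists x; apply: fP. Qed.

Lemma genericW P Q : (forall x, P x -> Q x) -> generic P -> generic Q.
Proof. by move=> PQ [f fP [nz fPx]]; exists f => //; split=> // x /fPx/PQ. Qed.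

Lemma generic_neq0 f : polyfun f -> (exists x, f x != 0) -> generic (fun x => f x != 0).
Proof. by move=> fP nz; exists f. Qed.

Lemma genericI P Q : generic P -> generic Q -> generic (fun x => P x /\ Q x).
Proof.
move=> [f fP [f0 fPx]] [g gP [g0 gQx]]; exists (fun x => f x * g x); first exact: polyfunM.
split; first exact: polyfun_neq0.
by move=> x; rewrite mulf_eq0 => /norP[/fPx ? /gQx].
Qed.

Lemma generic_all (I : finType) (P : I -> (V -> F) -> Prop) :
  (forall i, generic (P i)) -> generic (fun x => forall i, P i x).
Proof.
move=> gP; suff: generic (fun x => forall i, i \in enum I -> P i x).
  by apply: genericW => x Px i; apply: Px; rewrite mem_enum.
elim: (enum I) => [|i s IHs].
  by exists (fun=> 1); [exact: polyfun_cst | split=> //; exists (fun=> 0); rewrite oner_eq0].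
apply: genericW (genericI (gP i) IHs) => x [Pi Ps] j.
by rewrite inE => /predU1P[->|/Ps].
Qed.

Lemma generic_imp (b : bool) P : (b -> generic P) -> generic (fun x => b -> P x).
Proof.
case: b => [/(_ isT)|_]; first by apply: genericW => x.
by exists (fun=> 1); [exact: polyfun_cst | split=> //; exists (fun=> 0); rewrite oner_eq0].
Qed.

(** Allows an identity between polynomial functions to be checked on a nonempty open subset only. *)
Lemma polyfun_eq0 f g : polyfun f -> polyfun g -> (exists x, f x != 0) ->
  (forall x, f x * g x = 0) -> forall x, g x = 0.
Proof.
move=> fP gP f0 fg0 x; apply/eqP/contraT => gx.
by have [y] := polyfun_neq0 fP gP f0 (ex_intro _ x gx); rewrite fg0 eqxx.
Qed.

End PolynomialFunctions.

(** * Linear independence as an open condition *)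

Section LinearIndependence.
Variable F : numFieldType.

Definition lin_free (R E : finType) (u : R -> E -> F) : Prop :=
  forall c : R -> F, (forall e, \sum_r c r * u r e = 0) -> forall r, c r = 0.

Lemma lin_free_rinv (R E : finType) (u : R -> E -> F) : lin_free u ->
  exists B : E -> R -> F, forall r s, \sum_e u r e * B e s = (r == s)%:R.
Proof.
move=> free_u; pose A := \matrix_(i < #|R|, j < #|E|) u (enum_val i) (enum_val j).
have /row_freeP[B AB] : row_free A.
  apply: inj_row_free => v vA; apply/rowP => i; rewrite mxE.
  have := free_u (fun r => v 0 (enum_rank r)) _ (enum_val i); rewrite enum_valK; apply.
  move=> e; have := congr1 (fun w : 'rV_#|E| => w 0 (enum_rank e)) vA.
  rewrite !mxE => vAe; rewrite -[RHS]vAe.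
  rewrite (reindex (@enum_val R R)) /=; last exact/onW_bij/enum_val_bij.
  by apply: eq_bigr => j _; rewrite mxE enum_valK enum_rankK.
exists (fun e s => B (enum_rank e) (enum_rank s)) => r s.
have := congr1 (fun M : 'M_#|R| => M (enum_rank r) (enum_rank s)) AB.
rewrite !mxE (inj_eq enum_rank_inj) => <-.
rewrite (reindex (@enum_val E E)) /=; last exact/onW_bij/enum_val_bij.
by apply: eq_bigr => j _; rewrite mxE enum_valK enum_rankK.
Qed.

Lemma det_lin_free n (E : finType) (u : 'I_n -> E -> F) (B : E -> 'I_n -> F) :
  \det (\matrix_(i, j) \sum_e u i e * B e j) != 0 -> lin_free u.
Proof.
set M := \matrix_(_, _) _ => M_neq0 c c0 i.
have MU : M \in unitmx by rewrite unitmxE unitfE.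
have : (\row_k c k) *m M = 0.
  apply/rowP => j; rewrite !mxE.
  under eq_bigr do rewrite !mxE mulr_sumr.
  rewrite exchange_big big1 //= => e _.
  under eq_bigr do rewrite mulrA.
  by rewrite -mulr_suml c0 mul0r.
move/(congr1 (mulmxr (invmx M))); rewrite /= mulmxK // mul0mx.
by move/rowP/(_ i); rewrite !mxE.
Qed.

Lemma lin_free_reindex (R R' E : finType) (h : R' -> R) (u : R -> E -> F) :
  bijective h -> lin_free (u \o h) -> lin_free u.
Proof.
move=> [h' hK h'K] free_uh c c0 r; rewrite -[r]h'K; apply: (free_uh (c \o h)) => e.
by rewrite -[RHS](c0 e) [RHS](reindex h) //; exists h' => x _; [apply: hK | apply: h'K].
Qed.

Lemma lin_free_rinvP (R E : finType) (u : R -> E -> F) : lin_free u ->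
  exists B : E -> 'I_#|R| -> F,
    \det (\matrix_(i, j) \sum_e u (enum_val i) e * B e j) != 0.
Proof.
case/lin_free_rinv=> B uB; exists (fun e j => B e (enum_val j)).
rewrite (_ : \matrix_(_, _) _ = 1%:M) ?det1 ?oner_eq0 //.
by apply/matrixP => i j; rewrite !mxE uB (inj_eq enum_val_inj).
Qed.

(** Lower semicontinuity of the rank: with the right inverse [B] of the family at [x0] kept fixed,
    the determinant of the product with [B] is a polynomial function that is nonzero at [x0]. *)
Lemma generic_lin_free (V R E : finType) (u : (V -> F) -> R -> E -> F) x0 :
    (forall r e, polyfun (fun x => u x r e)) -> lin_free (u x0) ->
  generic (fun x => lin_free (u x)).
Proof.
move=> uP /lin_free_rinvP[B uB].
exists (fun x => \det (\matrix_(i, j) \sum_e u x (enum_val i) e * B e j)).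
  apply: polyfun_det => i j; apply: polyfun_sum => e.
  by apply: polyfunM (polyfun_cst _ _).
split; first by exists x0.
move=> x /det_lin_free free_ux; apply: (lin_free_reindex (h := @enum_val R R)) => //.
exact: enum_val_bij.
Qed.

End LinearIndependence.

(** * Algebraic dependence and tangent vectors to the closure of an image *)

Section AlgebraicDependence.
Variable F : numFieldType.

Lemma msizeM_leq n (p q : {mpoly F[n]}) d e :
  (msize p <= d.+1)%N -> (msize q <= e.+1)%N -> (msize (p * q)%R <= (d + e).+1)%N.
Proof.
have [->|p_neq0] := eqVneq p 0; first by rewrite mul0r msize0.
have [->|q_neq0] := eqVneq q 0; first by rewrite mulr0 msize0.
move=> le_pd le_qe; rewrite msizeM //.
have -> : (d + e).+1 = (d.+1 + e.+1).-1 by rewrite addnS.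
by rewrite -!subn1 leq_sub2r // leq_add.
Qed.

Lemma msizeX_leq n (p : {mpoly F[n]}) d k :
  (msize p <= d.+1)%N -> (msize (p ^+ k) <= (k * d).+1)%N.
Proof.
move=> le_pd; elim: k => [|k IHk]; first by rewrite expr0 msize1.
by rewrite exprS mulSn; apply: msizeM_leq.
Qed.

Lemma msize_prod_leq n (I : finType) (p : I -> {mpoly F[n]}) (d : I -> nat) :
  (forall i, msize (p i) <= (d i).+1)%N -> (msize (\prod_i p i)%R <= (\sum_i d i).+1)%N.
Proof.
move=> le_pd; apply: (big_rec2 (fun q e => msize q <= e.+1)%N).
  by rewrite msize1.
by move=> i e q _ le_qe; apply: msizeM_leq.
Qed.

(* There are more monomials in the [p i] of degree less than [D] in each variable than
   monomials in [N] variables that can occur in them. *)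
Lemma algebraic_dependence N (p : 'I_N.+1 -> {mpoly F[N]}) :
  exists2 q : {mpoly F[N.+1]}, q != 0 & forall x, q.@[fun i => (p i).@[x]] = 0.
Proof.
pose d := (\max_i msize (p i))%N.
have le_pd i : (msize (p i) <= d.+1)%N by apply/leqW/(leq_bigmax i).
(* Each [P a] has degree at most (N + 1)Dd < K, so that at most K^N = D^N c^N monomials occur. This
   is less than the number D^(N + 1) of the [P a], because D > c^N. *)
pose c := (N.+1 * d + 1)%N; pose D := (c ^ N).+1; pose K := (D * c)%N.
pose mon (a : {ffun 'I_N.+1 -> 'I_D}) := [multinom (a i : nat) | i < N.+1].
have mon_inj : injective mon.
  move=> a b /mnmP eq_ab; apply/ffunP => i; apply: val_inj.
  by have := eq_ab i; rewrite !mnmE.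
pose P (a : {ffun 'I_N.+1 -> 'I_D}) := \prod_i p i ^+ a i.
have le_PK a : (msize (P a) <= K)%N.
  have le_aD : (\sum_(i < N.+1) a i <= N.+1 * D)%N.
    rewrite -[X in (X * _)%N]card_ord -sum_nat_const.
    by apply: leq_sum => i _; rewrite ltnW.
  have : (msize (P a) <= (\sum_(i < N.+1) a i * d).+1)%N.
    by apply: msize_prod_leq => i; apply: msizeX_leq.
  move=> /leq_trans; apply; rewrite -big_distrl /=.
  apply: leq_ltn_trans (leq_mul le_aD (leqnn d)) _.
  by rewrite /K /c mulnDr muln1 mulnAC mulnC -[X in (X < _)%N]addn0 ltn_add2l.
pose col (b : {ffun 'I_N -> 'I_K}) := [multinom (b i : nat) | i < N].
pose M := \matrix_(i < #|{ffun 'I_N.+1 -> 'I_D}|, j < #|{ffun 'I_N -> 'I_K}|)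
  (P (enum_val i))@_(col (enum_val j)).
have lt_rank : (\rank M < #|{ffun 'I_N.+1 -> 'I_D}|)%N.
  apply: leq_ltn_trans (rank_leq_col _) _.
  by rewrite !card_ffun !card_ord expnMn mulnC expnS ltn_pmul2r ?expn_gt0.
have : kermx M != 0 by rewrite -mxrank_eq0 mxrank_ker -lt0n subn_gt0.
case/rowV0Pn=> v /sub_kermxP vM /rV0Pn[i0 vi0].
pose q := \sum_i v 0 i *: 'X_[mon (enum_val i)].
exists q.
  apply: contraNneq vi0 => /(congr1 (mcoeff (mon (enum_val i0)))).
  rewrite mcoeff0 raddf_sum (bigD1 i0) //= big1 ?addr0.
    by rewrite mcoeffZ mcoeffX eqxx mulr1 => ->.
  move=> i ne_i; rewrite mcoeffZ mcoeffX (inj_eq mon_inj) (inj_eq enum_val_inj).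
  by rewrite (negPf ne_i) mulr0.
have PM0 : \sum_i v 0 i *: P (enum_val i) = 0.
  apply/mpolyP => m; rewrite mcoeff0 raddf_sum /=.
  have [lt_mK|] := boolP [forall i, (m i < K)%N].
    have ltK i : (m i < K)%N by apply: (forallP lt_mK).
    have := congr1 (fun w : 'rV_ _ => w 0 (enum_rank [ffun i => Ordinal (ltK i)])) vM.
    rewrite !mxE => vMm; rewrite -[RHS]vMm; apply: eq_bigr => i _.
    rewrite mcoeffZ mxE enum_rankK; congr (_ * _@_ _).
    by apply/mnmP => k; rewrite mnmE ffunE.
  case/forallPn=> k; rewrite -leqNgt => le_Km; apply: big1 => i _.
  rewrite mcoeffZ memN_msupp_eq0 ?mulr0 //; apply: msize_mdeg_ge.
  apply: leq_trans (le_PK _) (leq_trans le_Km _).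
  by rewrite mdegE (bigD1 k) //= leq_addr.
move=> x; rewrite -[RHS](meval0 x) -PM0 /q !raddf_sum; apply: eq_bigr => i _.
rewrite /= !mevalZ mevalX rmorph_prod; congr (_ * _); apply: eq_bigr => k _.
by rewrite mnmE rmorphXn.
Qed.

Lemma diff_line_eq0 n (q : {mpoly F[n]}) (a b : 'I_n -> F) :
  (forall t, q.@[fun i => a i + t * b i] = 0) -> \sum_i q^`M(i).@[a] * b i = 0.
Proof.
have [p pE <-] := meval_line q a b => q0.
by rewrite (poly_eq0 (fun t _ => etrans (esym (pE t)) (q0 t))) deriv0 horner0.
Qed.

Definition shift (V : finType) (x : V -> F) v t : V -> F := fun w => x w + t * (w == v)%:R.

(* In a relation of minimal degree not all partial derivatives vanish on the image; if
   the last one did, independence of the differentials of the other functions would kill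
   the remaining ones. *)
Lemma separable_relation (V : finType) (N := #|V|) (g : 'I_N.+1 -> (V -> F) -> F)
    (D : 'I_N.+1 -> V -> (V -> F) -> F) :
    (forall i, polyfun (g i)) ->
    (forall i x v t, g i (shift x v t) = g i x + t * D i v x) ->
    generic (fun x => lin_free (fun (k : 'I_N) v => D (lift ord_max k) v x)) ->
  exists2 q : {mpoly F[N.+1]}, forall x, q.@[g^~ x] = 0 &
    exists x, q^`M(ord_max).@[g^~ x] != 0.
Proof.
move=> gP gD Dfree.
have [q q_neq0 q0] : exists2 q : {mpoly F[N.+1]}, q != 0 & forall x, q.@[g^~ x] = 0.
  have [p gp] := choice gP; have [q q_neq0 qp0] := algebraic_dependence p.
  by exists q => // x; rewrite -[RHS](qp0 (x \o enum_val)); apply: meval_eq.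
have [n le_qn] := ubnP (msize q); elim: n q le_qn q_neq0 q0 => // n IHn q lt_qn q_neq0 q0.
have [[x qx]|all0] := pselect (exists x, q^`M(ord_max).@[g^~ x] != 0).
  by exists q => //; exists x.
have qmax0 x : q^`M(ord_max).@[g^~ x] = 0.
  by apply/eqP/contraT => nz; case: all0; exists x.
have dq0 k x : q^`M(k).@[g^~ x] = 0.
  (* The differentials are known to be independent only where [f] is nonzero; multiplying by [f]
     reduces the identity to that open set. *)
  case: Dfree => f fP [f0 Dfree]; move: x.
  apply: (@polyfun_eq0 _ _ f _ fP (polyfun_meval _ gP) f0) => x.
  have [->|/Dfree free_x] := eqVneq (f x) 0; first by rewrite mul0r.
  have [k' ->|->] := unliftP ord_max k; last by rewrite qmax0 mulr0.
  rewrite (free_x (fun k => q^`M(lift ord_max k).@[g^~ x])) ?mulr0 // => v.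
  rewrite -[RHS](@diff_line_eq0 _ q (g^~ x) (fun i => D i v x)).
    by rewrite [RHS](bigD1_ord ord_max) //= qmax0 mul0r add0r.
  by move=> t; rewrite -(q0 (shift x v t)); apply: meval_eq => i; rewrite gD.
(* A nonzero partial derivative is again a relation, of smaller degree. If there is none, [q] is a
   constant that vanishes on the image, hence zero. *)
have [/existsP[i di]|] := boolP [exists i, q^`M(i) != 0].
  by apply: IHn di (dq0 i); apply: leq_trans (msize_mderiv _ q_neq0) _.
move/existsPn=> d0; have qC : q = (q@_0)%:MP.
  by apply: mderiv_eq0 => i; apply/eqP; rewrite -[_ == _]negbK.
have := q0 (fun=> 0); rewrite qC mevalC => q00.
by rewrite qC q00 mpolyC0 eqxx in q_neq0.
Qed.

(* Projecting linearly to [#|V|] coordinates keeps the rank of the differential, and each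
   remaining coordinate satisfies a separable relation with the projected ones; these
   relations cut the tangent space of the closure of the image down to dimension [#|V|]. *)
Lemma generic_tangent (V : finType) r (f : 'I_r -> (V -> F) -> F)
    (D : 'I_r -> V -> (V -> F) -> F) :
    (forall i, polyfun (f i)) -> (forall i v, polyfun (D i v)) ->
    (forall i x v t, f i (shift x v t) = f i x + t * D i v x) ->
    (exists x, lin_free (fun v i => D i v x)) ->
  generic (fun x => forall w : 'I_r -> F,
    (forall q : {mpoly F[r]}, (forall y, q.@[f^~ y] = 0) ->
       forall t, q.@[fun i => f i x + t * w i] = 0) ->
    exists c : V -> F, forall i, w i = \sum_v c v * D i v x).
Proof.
move=> fP DP fD [x0 /lin_free_rinv[B DB]].
(* The indices other than [ord_max] carry the projection by [B], which is the same for all [e]; the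
   index [ord_max] carries the coordinate [e] itself. *)
pose proj (w : 'I_r -> F) e (j : 'I_#|V|.+1) :=
  if unlift ord_max j is Some k then \sum_i w i * B i (enum_val k) else w e.
have projD w1 w2 t e j :
    proj (fun i => w1 i + t * w2 i) e j = proj w1 e j + t * proj w2 e j.
  rewrite /proj; case: unlift => // k; rewrite mulr_sumr -big_split.
  by apply: eq_bigr => i _; rewrite mulrDl mulrA.
have projP (h : 'I_r -> (V -> F) -> F) e j :
    (forall i, polyfun (h i)) -> polyfun (fun x => proj (h^~ x) e j).
  move=> hP; rewrite /proj; case: unlift => // k.
  by apply: polyfun_sum => i; apply: polyfunM (polyfun_cst _ _).
pose g e j x := proj (f^~ x) e j; pose Dg e j v x := proj (fun i => D i v x) e j.
have Dg_free : generic (fun x =>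
    lin_free (fun (k : 'I_#|V|) v => \sum_i D i v x * B i (enum_val k))).
  apply: (generic_lin_free (x0 := x0)) => [k v|c c0 k].
    by apply: polyfun_sum => i; apply: polyfunM (polyfun_cst _ _).
  have := c0 (enum_val k); rewrite (bigD1 k) //= DB eqxx mulr1 big1 ?addr0 //.
  by move=> l ne_lk; rewrite DB (inj_eq enum_val_inj) eq_sym (negPf ne_lk) mulr0.
have rel e : exists q : {mpoly F[#|V|.+1]},
    (forall x, q.@[g e ^~ x] = 0) /\ exists x, q^`M(ord_max).@[g e ^~ x] != 0.
  have [q q0 dq] : exists2 q : {mpoly F[#|V|.+1]}, forall x, q.@[g e ^~ x] = 0 &
      exists x, q^`M(ord_max).@[g e ^~ x] != 0; last by exists q.
  apply: (@separable_relation V (g e) (Dg e)) => [j|j x v t|].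
  - exact: projP.
  - by rewrite /g /Dg -projD; congr proj; apply/funext => i; rewrite fD.
  - apply: genericW Dg_free => x; congr lin_free.
    by apply/funext => k; apply/funext => v; rewrite /Dg /proj liftK.
have [q qP] := choice rel.
have dq_neq0 : generic (fun x => forall e, (q e)^`M(ord_max).@[g e ^~ x] != 0).
  apply: generic_all => e; apply: generic_neq0 (qP e).2.
  by apply: polyfun_meval => j; apply: projP.
apply: genericW (genericI Dg_free dq_neq0) => x [free_x dq_x] w w_tan.
have [C DC] := lin_free_rinv free_x.
(* With these coefficients the combination of the derivatives has the same projection as [w], so
   that the difference [z] below projects to zero. *)
pose c v := \sum_l (\sum_i w i * B i (enum_val l)) * C v l.
have killed (u : 'I_r -> F) e : (forall t, (q e).@[fun j => g e j x + t * proj u e j] = 0) ->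
    \sum_j (q e)^`M(j).@[g e ^~ x] * proj u e j = 0.
  exact: diff_line_eq0.
have w_killed e : \sum_j (q e)^`M(j).@[g e ^~ x] * proj w e j = 0.
  apply: killed => t.
  (* Composing with the linear forms [l] pulls the relation back to a polynomial vanishing on the
     image of [f], to which [w_tan] applies. *)
  pose l (j : 'I_#|V|.+1) : {mpoly F[r]} :=
    if unlift ord_max j is Some k then \sum_i B i (enum_val k) *: 'X_i else 'X_e.
  have lE u j : (l j).@[u] = proj u e j.
    rewrite /l /proj; case: unlift => [k|]; last by rewrite mevalXU.
    by rewrite raddf_sum; apply: eq_bigr => i _ /=; rewrite mevalZ mevalXU mulrC.
  have := w_tan (q e \mPo [tuple l j | j < _]) _ t; rewrite comp_mpoly_meval => <-.
    by apply: meval_eq => j; rewrite tnth_mktuple lE projD.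
  move=> y; rewrite comp_mpoly_meval -[RHS]((qP e).1 y).
  by apply: meval_eq => j; rewrite tnth_mktuple lE.
have D_killed v e : \sum_j (q e)^`M(j).@[g e ^~ x] * proj (fun i => D i v x) e j = 0.
  apply: killed => t; rewrite -[RHS]((qP e).1 (shift x v t)); apply: meval_eq => j.
  by rewrite -projD; congr proj; apply/funext => i; rewrite fD.
exists c => e.
pose z i := w i - \sum_v c v * D i v x.
have projz j : proj z e j = proj w e j - \sum_v c v * proj (fun i => D i v x) e j.
  rewrite /proj /z; case: unlift => // k.
  under eq_bigr do rewrite mulrBl.
  rewrite sumrB; congr (_ - _).
  under eq_bigr do rewrite mulr_suml.
  rewrite exchange_big; apply: eq_bigr => v _ /=; rewrite mulr_sumr.
  by apply: eq_bigr => i _; rewrite mulrA.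
have projz0 k : proj z e (lift ord_max k) = 0.
  rewrite projz /proj liftK; apply/eqP; rewrite subr_eq0; apply/eqP.
  under [RHS]eq_bigr do rewrite mulr_suml.
  rewrite exchange_big /= (bigD1 k) //= [X in _ + X]big1 ?addr0.
    under [RHS]eq_bigr do rewrite -mulrA [C _ _ * _]mulrC.
    by rewrite -mulr_sumr DC eqxx mulr1.
  move=> l ne_lk; under eq_bigr do rewrite -mulrA [C _ _ * _]mulrC.
  by rewrite -mulr_sumr DC eq_sym (negPf ne_lk) mulr0.
have : \sum_j (q e)^`M(j).@[g e ^~ x] * proj z e j = 0.
  under eq_bigr do rewrite projz mulrBr.
  rewrite sumrB w_killed sub0r; apply/eqP; rewrite oppr_eq0; apply/eqP.
  under eq_bigr do rewrite mulr_sumr.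
  rewrite exchange_big big1 // => v _ /=.
  under eq_bigr do rewrite mulrCA.
  by rewrite -mulr_sumr D_killed mulr0.
(* Only the last term of the relation for [z] remains, and its factor [dq_x e] is nonzero; hence the
   coordinate [e] of [z] vanishes. *)
rewrite (bigD1_ord ord_max) //= [X in _ + X]big1 => [|k _]; last by rewrite projz0 mulr0.
rewrite addr0 => /eqP; rewrite mulf_eq0 (negPf (dq_x e)) /= /proj unlift_none.
by rewrite subr_eq0 => /eqP.
Qed.

End AlgebraicDependence.

(** * Images of polynomial maps and quantifier elimination *)

Section GenericImage.
Variables (F : numClosedFieldType) (V : finType) (r : nat) (f : 'I_r -> (V -> F) -> F).
Hypothesis fP : forall i, polyfun (f i).

Definition vanishes (q : {mpoly F[r]}) : Prop := forall x, q.@[f^~ x] = 0.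

Definition in_closure (w : 'I_r -> F) : Prop := forall q, vanishes q -> q.@[w] = 0.

Let env (w : 'I_r -> F) : seq F := [seq w i | i <- enum 'I_r].

Lemma mpoly_of_rterm (t : GRing.term F) : GRing.rterm t ->
  exists p : {mpoly F[r]}, forall w, GRing.eval (env w) t = p.@[w].
Proof.
elim: t => //= [i|c|n|t1 IH1 t2 IH2|t IH|t IH n|t1 IH1 t2 IH2|t IH n].
- move=> _; case: (ltnP i r) => [ltir|leri].
    exists 'X_(Ordinal ltir) => w; rewrite mevalXU /env.
    rewrite (nth_map (Ordinal ltir)) ?size_enum_ord //; congr w.
    by apply: val_inj; rewrite /= nth_enum_ord.
  by exists 0 => w; rewrite meval0 nth_default // size_map size_enum_ord.
- by exists c%:MP => w; rewrite mevalC.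
- by exists n%:R%:MP => w; rewrite mevalC.
- by case/andP=> /IH1[p pE] /IH2[q qE]; exists (p + q) => w; rewrite mevalD pE qE.
- by case/IH=> p pE; exists (- p) => w; rewrite mevalN pE.
- by case/IH=> p pE; exists (p *+ n) => w; rewrite mevalMn pE.
- by case/andP=> /IH1[p pE] /IH2[q qE]; exists (p * q) => w; rewrite mevalM pE qE.
- by case/IH=> p pE; exists (p ^+ n) => w; rewrite rmorphXn pE.
Qed.

(** The offset [k] leaves room for variables that hold the coordinates of the target. *)
Lemma rterm_of_mpoly n k (p : {mpoly F[n]}) :
  exists2 t : GRing.term F, GRing.rterm t &
    forall e, GRing.eval e t = p.@[fun i => e`_(k + i)].
Proof.
move: p; apply: mpoly_ring_ind => [c|i|p q [t tR tE] [u uR uE]|p q [t tR tE] [u uR uE]].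
- by exists (GRing.Const c) => // e; rewrite mevalC.
- by exists (GRing.Var F (k + i)) => // e; rewrite mevalXU.
- by exists (GRing.Add t u) => [|e] /=; rewrite ?tR // mevalD tE uE.
- by exists (GRing.Mul t u) => [|e] /=; rewrite ?tR // mevalM tE uE.
Qed.

(** The closure of the image is irreducible: an equation either holds on all of it, or fails
    wherever the difference of its two sides is nonzero. For a binary connective the two polynomials
    [h] are multiplied. *)
Lemma qf_eval_generic (phi : GRing.formula F) :
    GRing.qf_form phi && GRing.rformula phi ->
  exists2 h : {mpoly F[r]}, exists x, h.@[f^~ x] != 0 &
    exists b, forall w, in_closure w -> h.@[w] != 0 -> GRing.qf_eval (env w) phi = b.
Proof.
have nz1 : exists x : V -> F, (1 : {mpoly F[r]}).@[f^~ x] != 0.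
  by exists (fun=> 0); rewrite meval1 oner_eq0.
have nzM (h1 h2 : {mpoly F[r]}) : (exists x, h1.@[f^~ x] != 0) ->
    (exists x, h2.@[f^~ x] != 0) -> exists x, (h1 * h2).@[f^~ x] != 0.
  move=> h1nz h2nz; have [x] := polyfun_neq0 (polyfun_meval h1 fP) (polyfun_meval h2 fP) h1nz h2nz.
  by rewrite -mevalM; exists x.
elim: phi => //=.
- by move=> b _; exists 1 => //; exists b.
- move=> t1 t2 /andP[r1 r2]; have [p1 p1E] := mpoly_of_rterm r1.
  have [p2 p2E] := mpoly_of_rterm r2.
  have [p0|nz] := pselect (vanishes (p1 - p2)).
    exists 1 => //; exists true => w cw _; rewrite p1E p2E -subr_eq0 -mevalB.
    by rewrite cw ?eqxx.
  exists (p1 - p2).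
    have [//|z] := pselect (exists x, (p1 - p2).@[f^~ x] != 0).
    by case: nz => x; apply/eqP/contraT => nz; case: z; exists x.
  by exists false => w _; rewrite mevalB subr_eq0 -p1E -p2E => /negPf.
- move=> p1 IH1 p2 IH2 /andP[/andP[q1 q2] /andP[r1 r2]].
  have [|h1 h1nz [b1 h1P]] := IH1; first by rewrite q1.
  have [|h2 h2nz [b2 h2P]] := IH2; first by rewrite q2.
  exists (h1 * h2); first exact: nzM.
  exists (b1 && b2) => w cw; rewrite mevalM mulf_eq0 => /norP[nz1w nz2w].
  by rewrite h1P ?h2P.
- move=> p1 IH1 p2 IH2 /andP[/andP[q1 q2] /andP[r1 r2]].
  have [|h1 h1nz [b1 h1P]] := IH1; first by rewrite q1.
  have [|h2 h2nz [b2 h2P]] := IH2; first by rewrite q2.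
  exists (h1 * h2); first exact: nzM.
  exists (b1 || b2) => w cw; rewrite mevalM mulf_eq0 => /norP[nz1w nz2w].
  by rewrite h1P ?h2P.
- move=> p1 IH1 p2 IH2 /andP[/andP[q1 q2] /andP[r1 r2]].
  have [|h1 h1nz [b1 h1P]] := IH1; first by rewrite q1.
  have [|h2 h2nz [b2 h2P]] := IH2; first by rewrite q2.
  exists (h1 * h2); first exact: nzM.
  exists (b1 ==> b2) => w cw; rewrite mevalM mulf_eq0 => /norP[nz1w nz2w].
  by rewrite h1P ?h2P.
- move=> p IH /IH[h hnz [b hP]]; exists h => //.
  by exists (~~ b) => w cw nz; rewrite hP.
Qed.

Lemma holds_big_and (I : finType) (phi : I -> GRing.formula F) e :
  GRing.holds e (\big[GRing.And/GRing.Bool true]_i phi i)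
    <-> forall i, GRing.holds e (phi i).
Proof.
suff main s : GRing.holds e (\big[GRing.And/GRing.Bool true]_(i <- s) phi i)
    <-> {in s, forall i, GRing.holds e (phi i)}.
  by rewrite main; split=> all_phi i => [|_]; apply: all_phi; rewrite ?mem_index_enum.
elim: s => [|i s IHs]; first by rewrite big_nil.
rewrite big_cons /= IHs; split=> [[phi_i phi_s] j|all_phi].
  by rewrite inE => /predU1P[->|/phi_s].
by split=> [|j js]; apply: all_phi; rewrite inE ?eqxx ?js ?orbT.
Qed.

(* By quantifier elimination the truth value of [exists x, g x != 0 /\ f x = w] is constant
   for [w] in a nonempty open subset of the closure of the image of [f]. *)
Lemma generic_preimage (g : (V -> F) -> F) : polyfun g -> (exists x, g x != 0) ->
  exists2 h : {mpoly F[r]}, exists x, h.@[f^~ x] != 0 &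
    forall w, in_closure w -> h.@[w] != 0 ->
      exists2 x, g x != 0 & forall i, f i x = w i.
Proof.
move=> [pg gE] g_neq0; have [p pE] := choice fP.
have [tg tgR tgE] := rterm_of_mpoly r pg.
have p_term i : exists u : GRing.term F, GRing.rterm u /\
    forall e, GRing.eval e u = (p i).@[fun j => e`_(r + j)].
  by have [u uR uE] := rterm_of_mpoly r (p i); exists u.
have [t tP] := choice p_term.
(* The variables below [r] hold [w]; the next [#|V|] ones hold [x] and are quantified in [phi]. *)
pose body := GRing.And (GRing.Not (GRing.Equal tg (GRing.Const 0)))
  (\big[GRing.And/GRing.Bool true]_(i < r) GRing.Equal (GRing.Var F i) (t i)).
pose phi := foldr GRing.Exists body (iota r #|V|).
have phiR : GRing.rformula phi.
  rewrite /phi; elim: (iota _ _) => //=; rewrite tgR /=.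
  by elim/big_ind: _ => //= [a b -> ->|i _] //; have [-> _] := tP i.
have phiP w : GRing.holds (env w) phi <-> exists2 x, g x != 0 & forall i, f i x = w i.
  have env_nth (u : 'I_r -> F) (i : 'I_r) : (env u)`_i = u i.
    rewrite (nth_map i) ?size_enum_ord //; congr u.
    by apply: val_inj; rewrite /= nth_enum_ord.
  rewrite -GRing.foldExistsP; split=> [[e ee /= [gx fx]]|[x gx fx]].
    exists (fun v => e`_(r + enum_rank v)).
      apply: contra_not_neq gx => g0; rewrite tgE -[RHS]g0 gE; apply: meval_eq => i.
      by rewrite enum_valK.
    move=> i; have := (holds_big_and _ _).1 fx i; rewrite /= (tP i).2 -ee.
      rewrite env_nth => ->; rewrite pE; apply: meval_eq => j.
      by rewrite enum_valK.
    by rewrite inE mem_iota negb_and -ltnNge ltn_ord.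
  have xE (j : 'I_#|V|) :
      (env w ++ [seq x (enum_val j) | j <- enum 'I_#|V|])`_(r + j) = x (enum_val j).
    rewrite nth_cat size_map size_enum_ord ltnNge leq_addr /= addKn.
    rewrite (nth_map j) ?size_enum_ord //; congr (x (enum_val _)).
    by apply: val_inj; rewrite /= nth_enum_ord.
  exists (env w ++ [seq x (enum_val j) | j <- enum 'I_#|V|]).
    move=> i; rewrite inE mem_iota negb_and -ltnNge -leqNgt nth_cat.
    rewrite size_map size_enum_ord; case: ltnP => //= leri lei.
    rewrite !nth_default ?size_map -?enumT ?size_enum_ord //.
    by rewrite -(leq_add2l r) subnKC.
  split.
    move=> /= g0; move: gx; rewrite gE; apply/negP; rewrite negbK -[X in _ == X]g0 tgE.
    by apply/eqP/meval_eq => j; rewrite xE.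
  apply/holds_big_and => i /=; rewrite (tP i).2 nth_cat size_map size_enum_ord ltn_ord.
  by rewrite env_nth -fx pE; apply: meval_eq => j; rewrite xE.
have wf_elim := @ClosedFieldQE.wf_ex_elim F.
have ok_elim := @ClosedFieldQE.holds_ex_elim F (@solve_monicpoly F).
have [h h_neq0 [b hP]] := qf_eval_generic (GRing.quantifier_elim_wf wf_elim phiR).
have qeP w := GRing.quantifier_elim_rformP wf_elim ok_elim (env w) phiR.
(* The constant truth value is read off at the image of a point [x] where both [g] and the pullback
   of [h] are nonzero. *)
have b_true : b.
  have [x] := polyfun_neq0 (polyfun_meval h fP) (ex_intro _ pg gE) h_neq0 g_neq0.
  rewrite mulf_eq0 => /norP[hx gx].
  rewrite -(hP (f^~ x)) //.
  by apply/qeP/phiP; exists x.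
by exists h => // w cw hw; apply/phiP/qeP; rewrite hP.
Qed.

End GenericImage.

(** * Double points and multilinear polynomials *)

Section DoublePoints.
Variables (F : numFieldType) (K : finType).
Implicit Types (s : nat) (z : nat -> F) (y : K -> nat -> F) (E : nat -> bool) (A B : {set K}).

(* The value and the partial derivatives at [z] of the multilinear monomial with support [E]
   in the variables of index less than [s]. *)
Definition mon s z E : F := \prod_(i < s) (if E i then z i else 1).

Definition dmon s k z E : F :=
  \prod_(i < s) (if i == k :> nat then (E i)%:R else if E i then z i else 1).

Lemma monS s z E : mon s.+1 z E = mon s z E * (if E s then z s else 1).
Proof. by rewrite /mon big_ord_recr. Qed.

Lemma dmonS s k z E : (k < s)%N ->
  dmon s.+1 k z E = dmon s k z E * (if E s then z s else 1).
Proof. by move=> ltks; rewrite /dmon big_ord_recr /= gtn_eqF. Qed.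

Lemma dmon_last s z E : dmon s.+1 s z E = mon s z E * (E s)%:R.
Proof.
rewrite /dmon big_ord_recr /= eqxx; congr (_ * _).
by apply: eq_bigr => i _; rewrite ltn_eqF.
Qed.

Lemma eq_mon s z1 z2 E1 E2 : (forall i, (i < s)%N -> z1 i = z2 i) ->
  (forall i, (i < s)%N -> E1 i = E2 i) -> mon s z1 E1 = mon s z2 E2.
Proof. by move=> zz EE; apply: eq_bigr => i _; rewrite zz ?EE. Qed.

Lemma eq_dmon s k z1 z2 E1 E2 : (forall i, (i < s)%N -> z1 i = z2 i) ->
  (forall i, (i < s)%N -> E1 i = E2 i) -> dmon s k z1 E1 = dmon s k z2 E2.
Proof. by move=> zz EE; apply: eq_bigr => i _; rewrite zz ?EE. Qed.

(* Double points in [A] and simple points in [B] impose independent conditions on the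
   multilinear polynomials in [s] variables. *)
Definition indep s A B y : Prop :=
  forall (c : K -> F) (d : K -> nat -> F),
    (forall j, j \notin A :|: B -> c j = 0) -> (forall j i, j \notin A -> d j i = 0) ->
    (forall E, \sum_j (c j * mon s (y j) E + \sum_(i < s) d j i * dmon s i (y j) E) = 0) ->
  (forall j, c j = 0) /\ (forall j i, (i < s)%N -> d j i = 0).

Lemma indep_eq s A B y1 y2 : (forall j i, (i < s)%N -> y1 j i = y2 j i) ->
  indep s A B y1 -> indep s A B y2.
Proof.
move=> yy indep1 c d c0 d0 cd0; apply: indep1 => // E; rewrite -[RHS](cd0 E).
apply: eq_bigr => j _; congr (_ * _ + _); first by apply: eq_mon => // i; apply: yy.
by apply: eq_bigr => i _; congr (_ * _); apply: eq_dmon => // k; apply: yy.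
Qed.

(** Makes the finitely many supports that matter into an index type for matrices. *)
Definition ext s (e : {set 'I_s}) (i : nat) : bool :=
  if insub i is Some k then k \in e else false.

Lemma extE s (e : {set 'I_s}) (i : 'I_s) : ext e i = (i \in e).
Proof. by rewrite /ext valK. Qed.

Lemma ext_set s E i : (i < s)%N -> ext [set k : 'I_s | E k] i = E i.
Proof. by move=> ltis; rewrite (extE _ (Ordinal ltis)) inE. Qed.

Definition jet s y (rho : K * option 'I_s) E : F :=
  if rho.2 is Some k then dmon s k (y rho.1) E else mon s (y rho.1) E.

Definition active s A B : {set K * option 'I_s} :=
  [set rho | rho.1 \in (if rho.2 is Some _ then A else A :|: B)].

Lemma card_active s A B : [disjoint A & B] -> #|active s A B| = (#|A| * s.+1 + #|B|)%N.
Proof.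
move=> dAB; pose incl j : K * option 'I_s := (j, None).
have -> : active s A B = setX A [set: option 'I_s] :|: incl @: B.
  apply/setP => -[j o]; rewrite !inE /= andbT.
  have -> : ((j, o) \in incl @: B) = (o == None) && (j \in B).
    apply/imsetP/andP => [[i iB [-> ->]]|[/eqP-> jB]]; first by rewrite iB.
    by exists j.
  by case: o => [k|] /=; rewrite ?inE ?orbF.
rewrite cardsU disjoint_setI0 ?cards0 ?subn0.
  rewrite cardsX cardsT card_option card_ord card_imset // => i j [] //.
rewrite disjoint_sym disjoints_subset; apply/subsetP => _ /imsetP[j jB ->].
by rewrite !inE andbT (disjointFl dAB jB).
Qed.

Lemma big_jet s (I : K * option 'I_s -> F) :
  \sum_rho I rho = \sum_j (I (j, None) + \sum_(i < s) I (j, Some i)).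
Proof.
rewrite (eq_bigr (fun rho => I (rho.1, rho.2))) => [|[]//].
rewrite -(pair_bigA _ (fun j o => I (j, o))) /=; apply: eq_bigr => j _.
rewrite (bigD1 None) //= (reindex_omap Some id) //= => [|[]//].
by congr (_ + _); apply: eq_bigl => k; rewrite eqxx.
Qed.

Lemma jet_ext s y (rho : K * option 'I_s) E :
  jet y rho (ext [set k : 'I_s | E k]) = jet y rho E.
Proof.
case: rho => j [k|]; first by apply: eq_dmon => // i; apply: ext_set.
by apply: eq_mon => // i; apply: ext_set.
Qed.

(** Puts [indep] in the form of linear independence of a finite family, to which rank arguments
    apply. *)
Lemma indepP s A B y : indep s A B y <->
  forall C : K * option 'I_s -> F, (forall rho, rho \notin active s A B -> C rho = 0) ->
    (forall S : {set 'I_s}, \sum_rho C rho * jet y rho (ext S) = 0) -> forall rho, C rho = 0.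
Proof.
split=> [indep_y C C0 CS|free_y c d c0 d0 cd0].
  have [||E|c0 d0] := indep_y (fun j => C (j, None))
      (fun j i => if insub i is Some k then C (j, Some k) else 0).
  - by move=> j jAB; rewrite C0 // inE.
  - by move=> j i jA; case: insubP => // k _ _; rewrite C0 // inE.
  - rewrite -[RHS](CS [set k : 'I_s | E k]) big_jet; apply: eq_bigr => j _.
    rewrite jet_ext; congr (_ + _); apply: eq_bigr => i _.
    by rewrite valK jet_ext.
  - by case=> j [k|] //; have := d0 j k (ltn_ord k); rewrite valK.
pose C (rho : K * option 'I_s) := if rho.2 is Some k then d rho.1 k else c rho.1.
have C0 rho : C rho = 0.
  move: rho; apply: free_y => [[j [k|]]|S]; rewrite ?inE /C /=.
  - exact: d0.
  - by move=> jAB; apply: c0; rewrite inE.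
  - by rewrite big_jet -[RHS](cd0 (ext S)).
split=> [j|j i ltis]; first exact: (C0 (j, None)).
exact: (C0 (j, Some (Ordinal ltis))).
Qed.

Lemma generic_indep (V : finType) s A B (y : (V -> F) -> K -> nat -> F) x0 :
    (forall j i, polyfun (fun x => y x j i)) -> indep s A B (y x0) ->
  generic (fun x => indep s A B (y x)).
Proof.
move=> yP indep0; pose R := (K * option 'I_s)%type.
(* The columns [inr] force the coefficients of the inactive rows to vanish, so that freeness of all
   rows amounts to [indep]. *)
pose u x (rho : R) (col : {set 'I_s} + R) := match col with
  | inl e => (rho \in active s A B)%:R * jet (y x) rho (ext e)
  | inr rho' => (rho \notin active s A B)%:R * (rho == rho')%:R
  end.
have uP x : indep s A B (y x) <-> lin_free (u x).
  rewrite indepP; split=> free_x C.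
    move=> CE; have C0 rho : rho \notin active s A B -> C rho = 0.
      move=> inact; have := CE (inr rho); rewrite (bigD1 rho) //= inact eqxx !mulr1.
      rewrite big1 ?addr0 // => rho' ne; rewrite (negPf ne) !mulr0 //.
    apply: free_x => // S; rewrite -[RHS](CE (inl S)); apply: eq_bigr => rho _ /=.
    by have [_|/C0->] := boolP (rho \in _); rewrite ?mul1r ?mul0r.
  move=> C0 CS; apply: free_x => -[e|rho] /=.
    rewrite -[RHS](CS e); apply: eq_bigr => rho _.
    by have [_|/C0->] := boolP (rho \in _); rewrite ?mul1r ?mul0r.
  apply: big1 => rho' _; have [_|/C0->] := boolP (rho' \in _); last by rewrite mul0r.
  by rewrite mul0r mulr0.
have /generic_lin_free : lin_free (u x0) by apply/uP.
have jetP (rho : R) E : polyfun (fun x => jet (y x) rho E).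
  case: rho => j [k|]; apply: polyfun_prod => i; last first.
    by case: (E i); [apply: yP | apply: polyfun_cst].
  by case: eqP => _; [|case: (E i)]; (apply: yP || apply: polyfun_cst).
move=> gen_u; apply: genericW (gen_u _) => [x /uP //|rho [e|rho']].
  exact: polyfunM (polyfun_cst _ _) _.
exact: polyfun_cst.
Qed.

End DoublePoints.

(** * Existence of points imposing independent conditions *)

Section Existence.
Variables (F : numFieldType) (K : finType).
Implicit Types (s : nat) (z : nat -> F) (y : K -> nat -> F) (E : nat -> bool) (A B : {set K}).

Lemma mon_indicator s (S e : {set 'I_s}) :
  mon s (fun i => (ext S i)%:R) (ext e) = (e \subset S)%:R :> F.
Proof.
have [/fintype.subsetP sub|/subsetPn[i ie iS]] := boolP (e \subset S).
  apply: big1 => i _; rewrite !extE; case: ifP => // /sub -> //.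
by apply/eqP/prodf_eq0; exists i => //; rewrite !extE ie (negPf iS).
Qed.

(** At the indicator of [e] only the terms with support inside [e] survive, so the coefficients
    vanish by induction on the cardinality of [e]. *)
Lemma mon_total s (phi : {set 'I_s} -> F) :
  (forall z, \sum_e phi e * mon s z (ext e) = 0) -> forall e, phi e = 0.
Proof.
move=> phi0 e; have [n] := ubnP #|e|; elim: n e => // n IHn e lt_en.
rewrite -[RHS](phi0 (fun i => (ext e i)%:R)) (bigD1 e) //= mon_indicator subxx mulr1.
rewrite big1 ?addr0 // => e' ne; rewrite mon_indicator.
have [sub|_] := boolP (e' \subset e); last by rewrite mulr0.
rewrite IHn ?mul0r //; apply: leq_trans (proper_card _) lt_en.
by rewrite properEneq ne.
Qed.

(* The vectors [mon s z] span the space of tensors, so one of them lies outside the span of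
   the given family as long as this span is not everything. *)
Lemma indep_add_simple s A B y j0 : [disjoint A & B] -> j0 \notin A :|: B ->
    (#|A| * s.+1 + #|B| < 2 ^ s)%N -> indep s A B y ->
  exists z, indep s A (j0 |: B) (fun j => if j == j0 then z else y j).
Proof.
move=> dAB j0AB lt_card indep_y; pose D := active s A B.
pose M := \matrix_(e < #|{set 'I_s}|, rho < #|D|) jet y (enum_val rho) (ext (enum_val e)).
have : kermx M != 0.
  rewrite -mxrank_eq0 mxrank_ker -lt0n subn_gt0 (leq_ltn_trans (rank_leq_col _)) //.
  by rewrite card_active // -cardsT -powersetT card_powerset cardsT card_ord.
(* There are fewer active conditions than monomials, so a nonzero linear form [phi] kills all of
   them. *)
case/rowV0Pn=> v /sub_kermxP vM /rV0Pn[e0 ve0].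
pose phi (e : {set 'I_s}) := v 0 (enum_rank e).
have phi_jet rho : rho \in D -> \sum_e phi e * jet y rho (ext e) = 0.
  move=> rhoD; have := congr1 (fun w : 'rV_ _ => w 0 (enum_rank_in rhoD rho)) vM.
  rewrite !mxE => vMrho; rewrite -[RHS]vMrho (reindex (@enum_val _ {set 'I_s})) /=.
    by apply: eq_bigr => e _; rewrite mxE /phi enum_valK enum_rankK_in.
  exact/onW_bij/enum_val_bij.
have [z phi_z] : exists z, \sum_e phi e * mon s z (ext e) != 0.
  apply: contrapT => phi0; case/eqP: ve0; rewrite -[e0]enum_valK.
  apply: (mon_total (phi := phi)) => z; apply/eqP/contraT => nz.
  by case: phi0; exists z.
exists z; set y' := fun j => if j == j0 then z else y j.
move=> c d c0 d0 cd0.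
have jA_j j : j \in A -> j == j0 = false.
  by apply: contraTF => /eqP->; apply: contra j0AB => jA; rewrite inE jA.
(* Applying [phi] to the relation leaves only the term of the new point, on which [phi] is
   nonzero. *)
have c_j0 : c j0 = 0.
  have : \sum_e phi e * (\sum_j (c j * mon s (y' j) (ext e) +
      \sum_(i < s) d j i * dmon s i (y' j) (ext e))) = 0.
    by apply: big1 => e _; rewrite cd0 mulr0.
  under eq_bigr do rewrite mulr_sumr.
  rewrite exchange_big (bigD1 j0) //= [X in _ + X = _]big1 ?addr0.
    have d00 i : d j0 i = 0.
      by apply: d0; apply: contra j0AB => jA; rewrite inE jA.
    have tail e : \sum_(i < s) d j0 i * dmon s i (y' j0) (ext e) = 0.
      by apply: big1 => i _; rewrite d00 mul0r.
    under eq_bigr do rewrite tail addr0 mulrCA.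
    rewrite -mulr_sumr /y' eqxx => /eqP.
    by rewrite mulf_eq0 (negPf phi_z) orbF => /eqP.
  move=> j ne_j; rewrite /y' (negPf ne_j).
  under eq_bigr do rewrite mulrDr mulrCA mulr_sumr.
  rewrite big_split /= -mulr_sumr exchange_big /=.
  have -> : \sum_(i < s) \sum_e phi e * (d j i * dmon s i (y j) (ext e)) = 0.
    apply: big1 => i _; under eq_bigr do rewrite mulrCA.
    rewrite -mulr_sumr; have [jA|/d0->] := boolP (j \in A); last by rewrite mul0r.
    by rewrite (phi_jet (j, Some i)) ?mulr0 // inE.
  rewrite addr0; have [jAB|jAB] := boolP (j \in A :|: B).
    by rewrite (phi_jet (j, None)) ?mulr0 // inE.
  by rewrite c0 ?mul0r // !inE (negPf ne_j) /=; move: jAB; rewrite inE.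
apply: indep_y => // [j jAB|E].
  have [->//|ne_j] := eqVneq j j0; rewrite c0 //.
  by rewrite !inE (negPf ne_j) /=; move: jAB; rewrite inE.
rewrite -[RHS](cd0 E); apply: eq_bigr => j _; rewrite /y'.
have [->|_] := eqVneq j j0; last by [].
rewrite c_j0 !mul0r; congr (_ + _); apply: eq_bigr => i _.
by rewrite d0 ?mul0r //; apply: contra j0AB => jA; rewrite inE jA.
Qed.

Lemma indep_add_simples s A B y : [disjoint A & B] -> (#|A| * s.+1 + #|B| <= 2 ^ s)%N ->
  indep s A set0 y -> exists y', indep s A B y'.
Proof.
have [n] := ubnP #|B|; elim: n B => // n IHn B lt_Bn dAB le_card indep_y.
have [->|[j jB]] := set_0Vmem B; first by exists y.
have dAB' : [disjoint A & B :\ j] by apply: disjointWr dAB; apply: subD1set.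
have cardB := cardsD1 j B; rewrite jB in cardB.
have [||y' indep_y'] := IHn (B :\ j) _ dAB' _ indep_y; try by lia.
have [||z indep_z] := indep_add_simple dAB' _ _ indep_y' (j0 := j); last 1 first.
- by exists (fun i => if i == j then z else y' i); rewrite setD1K in indep_z.
- by rewrite !inE eqxx (disjointFl dAB jB).
- lia.
Qed.

(** At the origin the value sees only the monomial 1, and the derivative in direction [k] only the
    variable of index [k]. *)
Lemma indep_le1 s A : (#|A| <= 1)%N -> indep s A set0 (fun _ _ => 0 : F).
Proof.
move=> /card_le1_eqP A1 c d c0 d0 cd0.
have cdA j E : j \in A ->
    c j * mon s (fun=> 0) E + \sum_(i < s) d j i * dmon s i (fun=> 0) E = 0.
  move=> jA; rewrite -[RHS](cd0 E) (bigD1 j) //= [X in _ = _ + X]big1 ?addr0 // => i ne_ij.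
  have iA : i \notin A by apply: contra ne_ij => iA; apply/eqP/A1.
  rewrite c0 ?inE ?(negPf iA) // mul0r add0r big1 // => k _.
  by rewrite d0 ?mul0r.
have c_eq0 j : c j = 0.
  have [jA|jA] := boolP (j \in A); last by rewrite c0 // !inE orbF.
  have := cdA j (fun=> false) jA; rewrite [mon _ _ _]big1 // mulr1 big1 ?addr0 // => i _.
  by rewrite [dmon _ _ _ _](bigD1 i) //= eqxx mul0r mulr0.
split=> // j k ltks; have [jA|/d0//] := boolP (j \in A).
have := cdA j (pred1 k) jA; rewrite c_eq0 mul0r add0r (bigD1 (Ordinal ltks)) //=.
rewrite [dmon _ _ _ _]big1 => [|i _]; last by rewrite /=; case: (i == k :> nat).
rewrite mulr1 big1 ?addr0 // => i ne_ik.
by rewrite [dmon _ _ _ _](bigD1 i) //= eqxx -[_ == k]/(i == Ordinal ltks) (negPf ne_ik) mul0r mulr0.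
Qed.

(* Put the points of [A0] and [A1] on two parallel hyperplanes. The restrictions [g0] and [g1]
   of a multilinear polynomial to them are arbitrary, and a double point on one hyperplane
   imposes a double point there and a simple one on the other. *)
Lemma indep_split s A0 A1 y : [disjoint A0 & A1] -> indep s A0 A1 y -> indep s A1 A0 y ->
  indep s.+1 (A0 :|: A1) set0 (fun j i => if i == s then (j \in A1)%:R else y j i).
Proof.
move=> dA indep01 indep10 c d c0 d0 cd0; pose t j : F := (j \in A1)%:R.
(* [S0] and [S1] test the relation on monomials without and with the variable z_s. Thus [S0 - S1]
   tests it on multiples of 1 - z_s, where only the points of [A0] keep derivatives in the first [s]
   variables, and [S1] on multiples of z_s, where only those of [A1] do. *)
pose S0 E := \sum_j (c j * mon s (y j) E + \sum_(i < s) d j i * dmon s i (y j) E).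
pose S1 E := \sum_j ((c j * t j + d j s) * mon s (y j) E
                     + \sum_(i < s) d j i * t j * dmon s i (y j) E).
have monE j E b : mon s (fun i => if i == s then t j else y j i)
    (fun i => if i == s then b else E i) = mon s (y j) E.
  by apply: eq_mon => i ltis; rewrite ltn_eqF.
have dmonE j k E b : dmon s k (fun i => if i == s then t j else y j i)
    (fun i => if i == s then b else E i) = dmon s k (y j) E.
  by apply: eq_dmon => i ltis; rewrite ltn_eqF.
have S0_eq0 E : S0 E = 0.
  rewrite -[RHS](cd0 (fun i => if i == s then false else E i)); apply: eq_bigr => j _.
  rewrite monS monE eqxx mulr1 big_ord_recr /= dmon_last eqxx mulr0 mulr0 addr0.
  congr (_ + _); apply: eq_bigr => i _.
  by rewrite dmonS // dmonE eqxx mulr1.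
have S1_eq0 E : S1 E = 0.
  rewrite -[RHS](cd0 (fun i => if i == s then true else E i)); apply: eq_bigr => j _.
  rewrite monS monE eqxx big_ord_recr /= dmon_last monE eqxx mulr1 mulrDl -addrA.
  rewrite -mulrA [t j * _]mulrC; congr (_ + _); rewrite addrC; congr (_ + _).
  by apply: eq_bigr => i _; rewrite dmonS // dmonE eqxx -mulrA [t j * _]mulrC.
have cA j : j \notin A0 :|: A1 -> c j = 0 by move=> jA; rewrite c0 // setU0.
have [|||c'0 d'0] := indep01 (fun j => c j * (1 - t j) - d j s) (fun j i => d j i * (1 - t j)).
- by move=> j jA; rewrite cA // d0 // mul0r subr0.
- move=> j i jA0; have [jA1|jA1] := boolP (j \in A1); first by rewrite /t jA1 subrr mulr0.
  by rewrite d0 ?mul0r // inE negb_or jA0.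
- move=> E; transitivity (S0 E - S1 E); last by rewrite S0_eq0 S1_eq0 subrr.
  rewrite -sumrB; apply: eq_bigr => j _; rewrite opprD addrACA -mulrBl -sumrB; congr (_ * _ + _).
    by ring.
  by apply: eq_bigr => i _; rewrite -mulrBl; congr (_ * _); ring.
have [|||c''0 d''0] := indep10 (fun j => c j * t j + d j s) (fun j i => d j i * t j).
- by move=> j; rewrite setUC => jA; rewrite cA // d0 // mul0r addr0.
- by move=> j i jA1; rewrite /t (negPf jA1) mulr0.
- by move=> E; rewrite -[RHS](S1_eq0 E).
have c_eq0 j : c j = 0.
  by have := congr2 +%R (c'0 j) (c''0 j); rewrite addr0 => <-; ring.
split=> // j i; rewrite ltnS leq_eqVlt => /predU1P[->|ltis].
  by have := c''0 j; rewrite c_eq0 mul0r add0r.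
by have := congr2 +%R (d'0 j i ltis) (d''0 j i ltis); rewrite addr0 => <-; ring.
Qed.

Lemma set_split A k : (k <= #|A|)%N ->
  exists A0 A1, [/\ A0 :|: A1 = A, [disjoint A0 & A1], #|A0| = k & #|A1| = (#|A| - k)%N].
Proof.
move=> le_kA; pose A0 := [set x in take k (enum A)].
have sub : A0 \subset A.
  by apply/fintype.subsetP => x; rewrite inE => /mem_take; rewrite mem_enum.
have cardA0 : #|A0| = k.
  rewrite cardsE (card_uniqP _) ?take_uniq ?enum_uniq //.
  by rewrite size_takel // -cardE.
exists A0, (A :\: A0); split=> //.
- by apply/setP => x; rewrite in_setU in_setD; have [/(fintype.subsetP sub)|] := boolP (x \in A0).
- by rewrite disjoint_sym disjoints_subset subsetDr.
- by rewrite cardsD (setIidPr sub) cardA0.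
Qed.

(** Provides the hypotheses of the induction for each half of [a] double points, the other half
    being counted as simple points. *)
Lemma split_arith s a : (1 < a)%N -> (a.+1 * s.+2 <= 2 ^ s.+1)%N ->
  let b := uphalf a in
  [/\ (b * s.+1 + (a - b) <= 2 ^ s)%N, ((a - b) * s.+1 + b <= 2 ^ s)%N,
      (b.+1 * s.+1 <= 2 ^ s)%N || (b <= 1)%N &
      ((a - b).+1 * s.+1 <= 2 ^ s)%N || (a - b <= 1)%N].
Proof.
move=> gt1 le_a b; have a2 : (2 * b <= a.+1)%N /\ (a <= 2 * b)%N.
  by rewrite /b uphalf_half; have := odd_double_half a; lia.
(* At k = s + 1 this reads (2s + 3)(s + 1) <= 2^(s + 1), which gives the bound on [b.+1] when a <=
   2s; when a >= 2s + 1 the hypothesis on [a] already gives it. *)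
have pow_ge k : (7 <= k -> 2 * k * k + k <= 2 ^ k)%N.
  elim: k => // k IHk; rewrite leq_eqVlt => /predU1P[<-//|ge7].
  by have := IHk ge7; rewrite expnS => le_k; nia.
rewrite expnS in le_a.
have [ge6|lt6] := leqP 6 s; last first.
  by move: s lt6 le_a => [|[|[|[|[|[|//]]]]]] _; rewrite ?expnS ?expn0 => le_a; split; lia.
have := pow_ge s.+1 ge6; rewrite expnS; split; nia.
Qed.

Lemma exists_indep s A B : [disjoint A & B] -> (#|A| * s.+1 + #|B| <= 2 ^ s)%N ->
    (#|A|.+1 * s.+1 <= 2 ^ s)%N || (#|A| <= 1)%N ->
  exists y : K -> nat -> F, indep s A B y.
Proof.
move=> dAB le_card condA; suff [y] : exists y : K -> nat -> F, indep s A set0 y.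
  exact: indep_add_simples.
elim: s A B dAB le_card condA => [|s IHs] A B dAB le_card condA.
  by exists (fun _ _ => 0); apply: indep_le1; lia.
have [le1|gt1] := leqP #|A| 1; first by exists (fun _ _ => 0); apply: indep_le1.
move: condA; rewrite (leqNgt #|A| 1) gt1 orbF => condA.
have [le0 le1 cond0 cond1] := split_arith gt1 condA.
have [|A0 [A1 [A01 dA cA0 cA1]]] := @set_split A (uphalf #|A|).
  by rewrite uphalf_half; lia.
rewrite -cA1 -cA0 in le0 le1 cond0 cond1.
have dA' : [disjoint A1 & A0] by rewrite disjoint_sym.
have [y0 /indep_add_simples-/(_ _ dA le0)[{}y0 indep0]] := IHs A0 A1 dA le0 cond0.
have [y1 /indep_add_simples-/(_ _ dA' le1)[{}y1 indep1]] := IHs A1 A0 dA' le1 cond1.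
(* The configurations [y0] and [y1] may differ. Both conditions are generic, so some configuration
   satisfies both. *)
pose y (x : K * 'I_s -> F) j i := if insub i is Some k then x (j, k) else 0.
have yP j i : polyfun (fun x => y x j i).
  by rewrite /y; case: insub => [k|]; [apply: polyfun_var | apply: polyfun_cst].
pose x0 (v : K * 'I_s) := y0 v.1 v.2; pose x1 (v : K * 'I_s) := y1 v.1 v.2.
have yx0 : indep s A0 A1 (y x0).
  by apply: indep_eq indep0 => j i ltis; rewrite /y insubT.
have yx1 : indep s A1 A0 (y x1).
  by apply: indep_eq indep1 => j i ltis; rewrite /y insubT.
have [x [i01 i10]] := generic_ex (genericI (generic_indep yP yx0) (generic_indep yP yx1)).
by exists (fun j i => if i == s then (j \in A1)%:R else y x j i); rewrite -A01; apply: indep_split.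
Qed.

End Existence.

(** * Uniqueness of decompositions *)

Section Decompositions.
Variables (F : numFieldType) (n : nat).
Implicit Types (s : nat) (y : 'I_n -> nat -> F) (E : nat -> bool) (v : nat -> 'rV[F]_2).

Definition tens s v E : F := \prod_(i < s) v i 0 (inord (E i)).

Lemma tensS s v E : tens s.+1 v E = tens s v E * v s 0 (inord (E s)).
Proof. by rewrite /tens big_ord_recr. Qed.

Lemma eq_tens s v E1 E2 : (forall i, (i < s)%N -> E1 i = E2 i) -> tens s v E1 = tens s v E2.
Proof. by move=> EE; apply: eq_bigr => i _; rewrite EE. Qed.

(** Used to separate the two slices of a tensor along its last factor. *)
Definition set_at s b E : nat -> bool := fun i => if i == s then b else E i.

Lemma mon_set_at s z b E : mon s z (set_at s b E) = mon s z E :> F.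
Proof. by apply: eq_mon => // i ltis; rewrite /set_at ltn_eqF. Qed.

Lemma dmon_set_at s k z b E : dmon s k z (set_at s b E) = dmon s k z E :> F.
Proof. by apply: eq_dmon => // i ltis; rewrite /set_at ltn_eqF. Qed.

Lemma tens_set_at s v b E : tens s v (set_at s b E) = tens s v E.
Proof. by apply: eq_tens => i ltis; rewrite /set_at ltn_eqF. Qed.

Lemma set_atE s b E : set_at s b E s = b.
Proof. by rewrite /set_at eqxx. Qed.

Lemma indep_mon s A B y (c : 'I_n -> F) : indep s A B y -> A :|: B = setT ->
  (forall E, \sum_j c j * mon s (y j) E = 0) -> forall j, c j = 0.
Proof.
move=> indep_y AB c0; have [|//|E|//] := indep_y c (fun _ _ => 0).
  by move=> j; rewrite AB inE.
rewrite -[RHS](c0 E); apply: eq_bigr => j _; rewrite [X in _ + X]big1 ?addr0 // => i _.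
by rewrite mul0r.
Qed.

(* Contracting the last tensor factor with the equation of [(1, y j0 s)] kills the derivatives
   at the point [j0], and the derivatives at the other points by independence. *)
Lemma tangent_contract s y j0 v (c : 'I_n -> F) (d : 'I_n -> nat -> F) :
    (forall j, j != j0 -> y j s != y j0 s) -> indep s [set~ j0] [set j0] y ->
    (forall E, tens s v E * (if E s then y j0 s else 1) =
       \sum_j (c j * mon s.+1 (y j) E + \sum_(i < s.+1) d j i * dmon s.+1 i (y j) E)) ->
  forall E, tens s v E =
    \sum_j c j * mon s (y j) E + \sum_(i < s) d j0 i * dmon s i (y j0) E.
Proof.
move=> y_neq indep_y tangE.
have E0 E : tens s v E = \sum_j (c j * mon s (y j) E + \sum_(i < s) d j i * dmon s i (y j) E).
  have := tangE (set_at s false E); rewrite set_atE mulr1 tens_set_at => ->.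
  apply: eq_bigr => j _; rewrite monS mon_set_at set_atE mulr1 big_ord_recr /=.
  rewrite dmon_last set_atE mulr0 mulr0 addr0; congr (_ + _); apply: eq_bigr => i _.
  by rewrite dmonS // dmon_set_at set_atE mulr1.
have E1 E : tens s v E * y j0 s = \sum_j ((c j * y j s + d j s) * mon s (y j) E
    + \sum_(i < s) d j i * y j s * dmon s i (y j) E).
  have := tangE (set_at s true E); rewrite set_atE tens_set_at => ->.
  apply: eq_bigr => j _; rewrite monS mon_set_at set_atE big_ord_recr /=.
  rewrite dmon_last mon_set_at set_atE mulr1 mulrDl -addrA.
  rewrite -mulrA [y j s * _]mulrC; congr (_ + _); rewrite addrC; congr (_ + _).
  by apply: eq_bigr => i _; rewrite dmonS // dmon_set_at set_atE -mulrA [y j s * _]mulrC.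
(* These are the coefficients of [y j0 s] times [E0] minus [E1], that is, of the contraction. *)
have [|||_ d0] := indep_y (fun j => c j * (y j0 s - y j s) - d j s)
    (fun j i => d j i * (y j0 s - y j s)).
- by move=> j; rewrite setUC setUCr inE.
- by move=> j i; rewrite !inE negbK => /eqP->; rewrite subrr mulr0.
- move=> E; transitivity (tens s v E * y j0 s - tens s v E * y j0 s); last exact: subrr.
  rewrite {1}E0 E1 mulr_suml -sumrB; apply: eq_bigr => j _.
  have -> : \sum_(i < s) d j i * (y j0 s - y j s) * dmon s i (y j) E =
      (\sum_(i < s) d j i * dmon s i (y j) E) * y j0 s
      - \sum_(i < s) d j i * y j s * dmon s i (y j) E.
    by rewrite mulr_suml -sumrB; apply: eq_bigr => i _; ring.
  by ring.
move=> E; rewrite E0 big_split /=; congr (_ + _).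
rewrite [LHS](bigD1 j0) //= [X in _ + X]big1 ?addr0 // => j ne_j.
apply: big1 => i _; have /eqP := d0 j i (ltn_ord i).
by rewrite mulf_eq0 subr_eq0 (eq_sym (y j0 s)) (negPf (y_neq _ ne_j)) orbF => /eqP->; rewrite mul0r.
Qed.

(** The difference of the two expressions involves derivatives at [j0] and [j1] only, and
    independence kills them. *)
Lemma tangent_meet s y j0 j1 (w : (nat -> bool) -> F) (c0 c1 : 'I_n -> F) (d0 d1 : nat -> F) :
    j0 != j1 -> indep s [set j0; j1] (~: [set j0; j1]) y ->
    (forall E, w E = \sum_j c0 j * mon s (y j) E + \sum_(i < s) d0 i * dmon s i (y j0) E) ->
    (forall E, w E = \sum_j c1 j * mon s (y j) E + \sum_(i < s) d1 i * dmon s i (y j1) E) ->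
  forall E, w E = \sum_j c0 j * mon s (y j) E.
Proof.
move=> ne01 indep_y w0 w1.
pose d j i := if j == j0 then d0 i else if j == j1 then - d1 i else 0.
have [|||_ d_eq0] := indep_y (fun j => c0 j - c1 j) d.
- by move=> j; rewrite setUCr inE.
- by move=> j i; rewrite !inE negb_or /d => /andP[/negPf-> /negPf->].
- move=> E; rewrite -[RHS](subrr (w E)) {1}w0 w1 big_split /= opprD addrACA; congr (_ + _).
    by rewrite -sumrB; apply: eq_bigr => j _; rewrite mulrBl.
  rewrite (bigD1 j0) //= (bigD1 j1) 1?eq_sym //= addrA [X in _ + X]big1 ?addr0.
    congr (_ + _); first by apply: eq_bigr => i _; rewrite /d eqxx.
    rewrite -sumrN; apply: eq_bigr => i _.
    by rewrite /d eq_sym (negPf ne01) eqxx mulNr.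
  move=> j /andP[/negPf nej0 /negPf nej1]; apply: big1 => i _.
  by rewrite /d nej0 nej1 mul0r.
move=> E; rewrite w0 [X in _ + X]big1 ?addr0 // => i _.
by have := d_eq0 j0 i (ltn_ord i); rewrite /d eqxx => ->; rewrite mul0r.
Qed.

(** The two slices of the tensor along the last factor are proportional, and independence on the
    first [s] factors turns this into an equation for [y j s] whenever [c j] is nonzero. As the
    [y j s] are distinct, at most one [c j] is nonzero unless the tensor is zero; the given index
    serves the zero tensor. *)
Lemma tens_in_span s y v (c : 'I_n -> F) : 'I_n ->
    (forall i j, i != j -> y i s != y j s) -> indep s set0 setT y ->
    (forall E, tens s.+1 v E = \sum_j c j * mon s.+1 (y j) E) ->
  exists j e, forall E, tens s.+1 v E = e * mon s.+1 (y j) E.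
Proof.
move=> i0 y_neq indep_y spanE; pose xi b := v s 0 (inord (b : bool)).
have [tens0|tens_nz] := pselect (forall E, tens s.+1 v E = 0).
  by exists i0, 0 => E; rewrite mul0r.
have c_xi j : c j * (xi true - xi false * y j s) = 0.
  move: j; apply: (indep_mon indep_y); first by rewrite set0U.
  move=> E; have := spanE (set_at s false E); have := spanE (set_at s true E).
  rewrite !tensS !tens_set_at !set_atE -!/(xi _) => E1 E0'.
  transitivity (tens s v E * xi false * xi true - tens s v E * xi true * xi false); last by ring.
  rewrite E1 E0' !mulr_suml -sumrB; apply: eq_bigr => j _.
  by rewrite !monS !mon_set_at !set_atE; ring.
have [c0|nz] := pselect (forall j, c j = 0).
  by exists i0, 0 => E; rewrite spanE mul0r big1 // => j _; rewrite c0 mul0r.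
have [j cj] : exists j, c j != 0.
  by apply: contrapT => all0; apply: nz => j; apply/eqP/contraT => cj; case: all0; exists j.
have xi_eq k : c k != 0 -> xi true = xi false * y k s.
  by move=> ck; have /eqP := c_xi k; rewrite mulf_eq0 (negPf ck) subr_eq0 => /eqP.
exists j, (c j) => E; rewrite spanE (bigD1 j) //= big1 ?addr0 // => k ne_kj.
have [->|ck] := eqVneq (c k) 0; first by rewrite mul0r.
case: tens_nz => E'; rewrite tensS -/(xi _).
have xi0 : xi false = 0.
  have := xi_eq k ck; rewrite (xi_eq j cj) => /eqP.
  rewrite -subr_eq0 -mulrBr mulf_eq0 subr_eq0 (eq_sym (y j s)) (negPf (y_neq _ _ ne_kj)) orbF.
  by move/eqP.
by case: (E' s); rewrite ?(xi_eq j cj) xi0 ?mul0r mulr0.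
Qed.

(** Comparing the coefficients of the independent [mon s (y j)], a nonzero [a j] forces some term
    [l] to lie over [j]. So [h] is surjective, hence injective, and each fibre is a single term
    equal to that of its point. *)
Lemma perm_of_proportional s y (a : 'I_n -> F) (v : 'I_n -> nat -> 'rV[F]_2) :
    (forall c : 'I_n -> F, (forall E, \sum_j c j * mon s (y j) E = 0) -> forall j, c j = 0) ->
    (forall j, a j != 0) ->
    (forall E, \sum_j a j * mon s.+1 (y j) E = \sum_l tens s.+1 (v l) E) ->
    (forall l, exists j e, forall E, tens s (v l) E = e * mon s (y j) E) ->
  exists2 h : 'I_n -> 'I_n, injective h &
    forall l E, tens s.+1 (v l) E = a (h l) * mon s.+1 (y (h l)) E.
Proof.
move=> mon_free a_neq0 decE prop.
have [h hP] := choice prop; have [e eP] := choice hP.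
pose xi l b := v l s 0 (inord (b : bool)).
have coef j b : a j * (if b then y j s else 1) = \sum_(l | h l == j) e l * xi l b.
  apply/eqP; rewrite -subr_eq0; apply/eqP; move: j; apply: mon_free => E.
  have := decE (set_at s b E).
  under eq_bigr do rewrite monS mon_set_at set_atE.
  under [RHS]eq_bigr do rewrite tensS tens_set_at eP set_atE -/(xi _ _).
  move=> dec; under eq_bigr do rewrite mulrBl.
  rewrite sumrB; apply/eqP; rewrite subr_eq0; apply/eqP.
  transitivity (\sum_j a j * (mon s (y j) E * (if b then y j s else 1))).
    by apply: eq_bigr => j _; ring.
  rewrite dec (partition_big h xpredT) //=; apply: eq_bigr => j _.
  by rewrite mulr_suml; apply: eq_bigr => l /eqP <-; ring.
have h_surj j : exists l, h l = j.
  have [l /eqP|noneq] := pickP [pred l | h l == j]; first by exists l.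
  have := coef j false; rewrite big_pred0 // mulr1 => /eqP; by rewrite (negPf (a_neq0 j)).
have h_inj : injective h.
  suff /image_injP h_in : #|image h 'I_n| == #|'I_n| by move=> l l' /h_in; apply.
  apply/eqP/eq_card => j; rewrite inE; apply/imageP.
  by have [l <-] := h_surj j; exists l.
exists h => // l E; rewrite tensS eP monS -/(xi _ _).
have := coef (h l) (E s); rewrite (big_pred1 l) => [|l']; last by rewrite (inj_eq h_inj).
by rewrite mulrA mulrAC => <-; ring.
Qed.

End Decompositions.

(** * An affine chart for sums of decomposable tensors *)

Section Chart.
Variables (F : numClosedFieldType) (n m : nat).
Let V := ('I_n * 'I_m.+1)%type.
Let r := (2 ^ m - 1).+1.
Implicit Types (x : V -> F) (E : nat -> bool).

Definition digit (e i : nat) : bool := odd (e %/ 2 ^ i).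

Lemma digit_surj E : exists e : 'I_r, forall i, (i < m)%N -> digit e i = E i.
Proof.
have [e lte eE] := bit_surj m E.
have lte' : (e < r)%N by rewrite /r subn1 prednK // expn_gt0.
have inord_inj (b b' : bool) : inord b = inord b' :> 'I_2 -> b = b'.
  by case: b b' => [] [] // /(congr1 val); rewrite /= !inordK.
by exists (Ordinal lte') => i /eE/inord_inj.
Qed.

(* A parameter consists of the affine coordinates of [n] points of (P^1)^m in the chart where the
   first coordinate of each factor is [1], followed by the coefficient of each point. *)
Definition chart_y x (j : 'I_n) (i : nat) : F := x (j, inord i).
Definition chart_a x (j : 'I_n) : F := x (j, ord_max).

Definition chart (e : 'I_r) x : F :=
  \sum_j chart_a x j * mon m (chart_y x j) (digit e).

Definition dchart (e : 'I_r) (v : V) x : F :=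
  if v.2 == ord_max then mon m (chart_y x v.1) (digit e)
  else chart_a x v.1 * dmon m v.2 (chart_y x v.1) (digit e).

Lemma polyfun_mon E j : polyfun (fun x => mon m (chart_y x j) E).
Proof. by apply: polyfun_prod => i; case: (E i); [apply: polyfun_var | apply: polyfun_cst]. Qed.

Lemma polyfun_chart e : polyfun (chart e).
Proof. by apply: polyfun_sum => j; apply: polyfunM (polyfun_var _ _) (polyfun_mon _ _). Qed.

Lemma polyfun_dchart e v : polyfun (dchart e v).
Proof.
rewrite /dchart; case: (v.2 == ord_max); first exact: polyfun_mon.
apply: polyfunM (polyfun_var _ _) _; apply: polyfun_prod => i.
by case: (_ == _); [|case: (digit e i)]; (apply: polyfun_var || apply: polyfun_cst).
Qed.

Lemma mon_shift i (z z' : nat -> F) t E : (i < m)%N -> z' i = z i + t ->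
    (forall k, (k < m)%N -> k != i -> z' k = z k) ->
  mon m z' E = mon m z E + t * dmon m i z E.
Proof.
move=> ltim z'i z'k; pose i0 := Ordinal ltim.
have split_i (g : nat -> F) : \prod_(l < m) g l = g i * \prod_(l < m | l != i0) g l.
  exact: (bigD1 i0).
rewrite /mon /dmon (split_i (fun l => if E l then z' l else 1)).
rewrite (split_i (fun l => if E l then z l else 1)).
rewrite (split_i (fun l => if l == i then (E l)%:R else if E l then z l else 1)) eqxx.
have -> : \prod_(l < m | l != i0) (if E l then z' l else 1) =
    \prod_(l < m | l != i0) (if E l then z l else 1).
  by apply: eq_bigr => l ne_li; rewrite z'k.
have -> : \prod_(l < m | l != i0)
      (if l == i :> nat then (E l)%:R else if E l then z l else 1) =
    \prod_(l < m | l != i0) (if E l then z l else 1).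
  by apply: eq_bigr => l ne_li; rewrite -[_ == i]/(l == i0) (negPf ne_li).
by rewrite z'i; case: (E i); rewrite /=; ring.
Qed.

(** [chart] has degree at most one in each variable, so the expansion to first order is exact. *)
Lemma chart_shift e x v t : chart e (shift x v t) = chart e x + t * dchart e v x.
Proof.
case: v => j i; rewrite /chart (bigD1 j) //= [in RHS](bigD1 j) //= addrAC; congr (_ + _).
  have y_shift k : (k < m)%N ->
      chart_y (shift x (j, i) t) j k = chart_y x j k + t * (k == i :> nat)%:R.
    move=> ltkm; rewrite /chart_y /shift xpair_eqE eqxx /=.
    by rewrite -val_eqE /= inordK // ltnS ltnW.
  rewrite /dchart /=; have [i_max|ne_i] := eqVneq i ord_max.
    subst i.
    rewrite /chart_a {1}/shift eqxx mulr1 mulrDl; congr (_ * _ + _ * _); apply: eq_mon => // k ltkm.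
      by rewrite y_shift // [(k == _)%N]ltn_eqF ?mulr0 ?addr0.
    by rewrite y_shift // [(k == _)%N]ltn_eqF ?mulr0 ?addr0.
  have ltim : (i < m)%N by rewrite ltn_neqAle -ltnS ltn_ord andbT.
  rewrite /chart_a {1}/shift xpair_eqE eqxx eq_sym (negPf ne_i) mulr0 addr0.
  rewrite (@mon_shift i (chart_y x j) _ t) //; first by ring.
    by rewrite y_shift // eqxx mulr1.
  by move=> k ltkm ne_ki; rewrite y_shift // (negPf ne_ki) mulr0 addr0.
apply: eq_bigr => l ne_lj; rewrite /chart_a {1}/shift xpair_eqE (negPf ne_lj) mulr0 addr0.
congr (_ * _); apply: eq_mon => // k _.
by rewrite /chart_y /shift xpair_eqE (negPf ne_lj) mulr0 addr0.
Qed.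

Definition point_at (y : 'I_n -> nat -> F) : V -> F :=
  fun v => if v.2 == ord_max then 1 else y v.1 v.2.

Lemma chart_y_point_at y j i : (i < m)%N -> chart_y (point_at y) j i = y j i.
Proof.
move=> ltim; rewrite /chart_y /point_at /= -val_eqE /= inordK ?ltn_eqF //.
exact: ltnW.
Qed.

Lemma chart_a_point_at y j : chart_a (point_at y) j = 1.
Proof. by rewrite /chart_a /point_at /= eqxx. Qed.

Lemma dchart_sum e x (c : V -> F) : \sum_v c v * dchart e v x =
  \sum_j (c (j, ord_max) * mon m (chart_y x j) (digit e) +
    \sum_(i < m) c (j, inord i) * chart_a x j * dmon m i (chart_y x j) (digit e)).
Proof.
rewrite (eq_bigr (fun v => c (v.1, v.2) * dchart e (v.1, v.2) x)) => [|[]//].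
rewrite -(pair_bigA _ (fun j i => c (j, i) * dchart e (j, i) x)) /=; apply: eq_bigr => j _.
rewrite big_ord_recr /= addrC {1}/dchart eqxx; congr (_ + _); apply: eq_bigr => i _.
have -> : widen_ord (leqnSn m) i = inord i.
  by apply: val_inj; rewrite /= inordK // ltnS ltnW.
rewrite /dchart /= -val_eqE /= inordK ?ltn_eqF ?mulrA //.
by rewrite ltnS ltnW.
Qed.

(** Terracini: when all coefficients are 1, the partial derivatives of [chart] are the values and
    derivatives at the double points. *)
Lemma dchart_free y : indep m setT set0 y ->
  lin_free (fun (v : V) e => dchart e v (point_at y)).
Proof.
move=> indep_y c c0.
have indep_y' : indep m setT set0 (chart_y (point_at y)).
  by apply: indep_eq indep_y => j i ltim; rewrite chart_y_point_at.
have [|||c'0 d0] := indep_y' (fun j => c (j, ord_max)) (fun j i => c (j, inord i)).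
- by move=> j; rewrite !inE.
- by move=> j i; rewrite !inE.
- move=> E; have [e eE] := digit_surj E; rewrite -[RHS](c0 e) dchart_sum.
  apply: eq_bigr => j _; congr (_ * _ + _); first by apply: eq_mon => // i /eE.
  apply: eq_bigr => i _; rewrite chart_a_point_at mulr1; congr (_ * _).
  by apply: eq_dmon => // k /eE.
case=> j i; have [->|ne_i] := eqVneq i ord_max; first exact: c'0.
have ltim : (i < m)%N by rewrite ltn_neqAle -ltnS ltn_ord andbT.
by have := d0 j i ltim; rewrite inord_val.
Qed.

(** Where the first coordinates of all factors are nonzero, they can be divided out and their
    product becomes the coefficient of the point. The vanishing of [q] extends from this open set to
    all tensors. *)
Lemma in_closure_tens (v : 'I_n -> nat -> 'rV[F]_2) :
  in_closure chart (fun e => \sum_l tens m (v l) (digit e)).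
Proof.
move=> q q0; pose U := ('I_n * 'I_m * bool)%type.
pose f (w : U -> F) := q.@[fun e : 'I_r => \sum_l \prod_(i < m) w (l, i, digit e i)].
pose g (w : U -> F) := \prod_l \prod_i w (l, i, false).
suff f0 w : f w = 0 by exact: (f0 (fun u => v u.1.1 u.1.2 0 (inord u.2))).
move: w; apply: (@polyfun_eq0 _ _ g f) => [|||w].
- by do 2![apply: polyfun_prod => ?]; apply: polyfun_var.
- apply: polyfun_meval => e; apply: polyfun_sum => l; apply: polyfun_prod => i.
  exact: polyfun_var.
- exists (fun=> 1); rewrite /g big1 ?oner_eq0 // => l _; exact: big1.
have [->|g_neq0] := eqVneq (g w) 0; first by rewrite mul0r.
have w_neq0 l i : w (l, i, false) != 0.
  by move: g_neq0 => /prodf_neq0/(_ l isT)/prodf_neq0/(_ i isT).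
pose y j i := if insub i is Some k then w (j, k, true) / w (j, k, false) else 0.
pose x (u : V) := if u.2 == ord_max then \prod_i w (u.1, i, false) else y u.1 u.2.
suff -> : f w = q.@[chart^~ x] by rewrite q0 mulr0.
apply: meval_eq => e; symmetry; apply: eq_bigr => j _.
rewrite /chart_a /x /= eqxx /mon -big_split /=.
apply: eq_bigr => i _; rewrite /chart_y -val_eqE /= inordK ?ltn_eqF //; last by rewrite ltnS ltnW.
by rewrite /y valK; case: (digit e i); rewrite ?mulr1 // mulrC divfK.
Qed.

End Chart.

(** * Uniqueness of the decomposition for generic parameters *)

Section GenericDecompositions.
Variables (F : numClosedFieldType) (k s : nat).
Local Notation n := k.+1.
Local Notation m := s.+2.
Hypothesis s_ge3 : (3 < s)%N.
Hypothesis small_rank : (n * m <= 2 ^ s.+1)%N.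
Let V := ('I_n * 'I_m.+1)%type.
Implicit Types (x : V -> F).

(** The slack condition for two double points in [s.+1] factors. *)
Let pow_ge : (3 * m <= 2 ^ s.+1)%N.
Proof.
have [t ->] : exists t, s = t.+4 by exists (s - 4)%N; lia.
by elim: t => // t IHt; rewrite expnS; lia.
Qed.

Lemma exists_indep_full : exists y : 'I_n -> nat -> F, indep m setT set0 y.
Proof.
apply: exists_indep; first by rewrite disjoint_sym disjoints_subset sub0set.
  by rewrite cardsT card_ord cards0 expnS; nia.
rewrite cardsT card_ord expnS; case: (k) small_rank => [|k'] rank; first by rewrite orbT.
by apply/orP; left; nia.
Qed.

(** For [k] double points in [s.+1] factors the slack condition is exactly [small_rank]. *)
Lemma exists_indep_but1 (j0 : 'I_n) :
  exists y : 'I_n -> nat -> F, indep s.+1 [set~ j0] [set j0] y.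
Proof.
have cardA : #|[set~ j0]| = k by rewrite cardsC1 card_ord.
apply: exists_indep; rewrite ?cardA ?cards1; first by rewrite disjoints_subset.
  by move: small_rank; rewrite mulSn; lia.
by rewrite small_rank.
Qed.

Lemma exists_indep_pair (j0 j1 : 'I_n) : j0 != j1 ->
  exists y : 'I_n -> nat -> F, indep s.+1 [set j0; j1] (~: [set j0; j1]) y.
Proof.
move=> ne01; have cardA : #|[set j0; j1]| = 2%N by rewrite cards2 ne01.
have cardB := cardsC [set j0; j1]; rewrite cardA card_ord in cardB.
apply: exists_indep; rewrite ?cardA; first by rewrite disjoints_subset setCK.
  by have := pow_ge; nia.
by rewrite pow_ge.
Qed.

Lemma exists_indep_simple : exists y : 'I_n -> nat -> F, indep s set0 setT y.
Proof.
apply: exists_indep; rewrite ?cards0 ?cardsT ?card_ord ?orbT //.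
  by rewrite disjoints_subset sub0set.
by move: small_rank; rewrite expnS; nia.
Qed.

Lemma generic_indep_chart t (A B : {set 'I_n}) : (t <= m)%N ->
    (exists y : 'I_n -> nat -> F, indep t A B y) ->
  generic (fun x => indep t A B (chart_y x)).
Proof.
move=> le_tm [y indep_y]; apply: (generic_indep (x0 := point_at y)) => [j i|].
  exact: polyfun_var.
apply: indep_eq indep_y => j i ltit; rewrite chart_y_point_at //.
exact: leq_trans ltit le_tm.
Qed.

Lemma generic_chart_y_neq i : (i < m)%N ->
  generic (fun x => forall j0 j1, j0 != j1 -> chart_y x j0 i != chart_y x j1 i).
Proof.
move=> ltim; apply: generic_all => j0; apply: generic_all => j1.
apply: generic_imp => ne01.
apply: (genericW (P := fun x => chart_y x j0 i - chart_y x j1 i != 0)) => [x|].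
  by rewrite subr_eq0.
apply: generic_neq0.
  under eq_fun do rewrite -mulN1r.
  apply: polyfunD (polyfun_var _ _) (polyfunM (polyfun_cst _ _) (polyfun_var _ _)).
exists (point_at (fun j _ => (j == j0)%:R)); rewrite !chart_y_point_at // eqxx.
by rewrite (eq_sym j1) (negPf ne01) subr0 oner_eq0.
Qed.

Lemma generic_chart_a_neq0 : generic (fun x => forall j, chart_a x j != 0).
Proof.
apply: generic_all => j; apply: generic_neq0; first exact: polyfun_var.
by exists (fun=> 1); rewrite oner_eq0.
Qed.

Lemma generic_unique_decomposition :
  generic (fun x => [/\ forall j, chart_a x j != 0,
    forall c : 'I_n -> F,
      (forall E, \sum_j c j * mon m (chart_y x j) E = 0) -> forall j, c j = 0 &
    forall v : 'I_n -> nat -> 'rV[F]_2,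
      (forall e, chart e x = \sum_l tens m (v l) (digit e)) ->
    exists2 h : 'I_n -> 'I_n, injective h &
      forall l E, tens m (v l) E = chart_a x (h l) * mon m (chart_y x (h l)) E]).
Proof.
have [y0 y0P] := exists_indep_full.
have free0 : exists x, lin_free (fun (v : V) e => dchart e v x).
  by exists (point_at y0); apply: dchart_free.
have gen_tan := generic_tangent (@polyfun_chart F n m) (@polyfun_dchart F n m)
  (@chart_shift F n m) free0.
have gen_but1 : generic (fun x => forall j0, indep s.+1 [set~ j0] [set j0] (chart_y x)).
  by apply: generic_all => j0; apply: generic_indep_chart (exists_indep_but1 j0).
have gen_pair : generic (fun x => forall j0 j1, j0 != j1 ->
    indep s.+1 [set j0; j1] (~: [set j0; j1]) (chart_y x)).
  apply: generic_all => j0; apply: generic_all => j1; apply: generic_imp => ne01.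
  exact: generic_indep_chart (exists_indep_pair ne01).
have gen_simple := generic_indep_chart (leqW (leqnSn s)) exists_indep_simple.
have gen_full := generic_indep_chart (leqnn m) exists_indep_full.
have gen_y := genericI (generic_chart_y_neq (ltnSn s.+1)) (generic_chart_y_neq (leqnSn s.+1)).
have := genericI (genericI (genericI gen_tan gen_but1) (genericI gen_pair gen_simple))
  (genericI (genericI gen_y generic_chart_a_neq0) gen_full).
apply: genericW => x [[[tanx but1x] [pairx simplex]] [[[y_neq y_neq'] a_neq0] fullx]].
have mon_free : forall c : 'I_n -> F,
    (forall E, \sum_j c j * mon s.+1 (chart_y x j) E = 0) -> forall j, c j = 0.
  by move=> c; apply: (indep_mon (but1x ord0)); rewrite setUC setUCr.
split=> //; first by move=> c; apply: (indep_mon fullx); rewrite setU0.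
move=> v vP.
have dec E : \sum_j chart_a x j * mon m (chart_y x j) E = \sum_l tens m (v l) E.
  have [e eE] := digit_surj m E; transitivity (chart e x).
    by apply: eq_bigr => j _; congr (_ * _); apply: eq_mon => // i /eE.
  by rewrite vP; apply: eq_bigr => l _; apply: eq_tens.
have tan l j0 : exists (c : 'I_n -> F) (d : 'I_n -> nat -> F), forall E,
    tens s.+1 (v l) E * (if E s.+1 then chart_y x j0 s.+1 else 1) =
    \sum_j (c j * mon m (chart_y x j) E + \sum_(i < m) d j i * dmon m i (chart_y x j) E).
  (* Adding [t] times (1, [chart_y x j0 s.+1]) to the last factor of the term [l] stays in the
     closure, so [tanx] applies to this direction. *)
  pose u t j : nat -> 'rV[F]_2 := fun i => if (j == l) && (i == s.+1) then
    v j i + t *: (\row_b (if b == 0 then 1 else chart_y x j0 s.+1)) else v j i.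
  have [q q0 t|c cE] := tanx (fun e => tens s.+1 (v l) (digit e) *
      (if digit e s.+1 then chart_y x j0 s.+1 else 1)).
    rewrite -[RHS](in_closure_tens (u t) q0); apply: meval_eq => e.
    rewrite vP (bigD1 l) //= [RHS](bigD1 l) //= addrAC; congr (_ + _).
      have u_last : u t l s.+1 = v l s.+1 +
          t *: (\row_b (if b == 0 then 1 else chart_y x j0 s.+1)) by rewrite /u !eqxx.
      rewrite [tens m (u t l) _]tensS [tens m (v l) _]tensS u_last !mxE mulrDr [t * (_ * _)]mulrCA.
      have -> : tens s.+1 (u t l) (digit e) = tens s.+1 (v l) (digit e).
        by apply: eq_bigr => i _; rewrite /u [(i == _ :> nat)]ltn_eqF // andbF.
      congr (_ + _ * (_ * _)); rewrite -val_eqE /= inordK; last by case: digit.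
      by case: digit.
    by apply: eq_bigr => j /negPf ne_jl; apply: eq_bigr => i _; rewrite /u ne_jl.
  exists (fun j => c (j, ord_max)), (fun j i => c (j, inord i) * chart_a x j) => E.
  have [e eE] := digit_surj m E; have := cE e; rewrite dchart_sum eE // => eqE.
  transitivity (tens s.+1 (v l) (digit e) * (if E s.+1 then chart_y x j0 s.+1 else 1)).
    by congr (_ * _); apply: eq_tens => i ltis; rewrite eE // ltnW.
  rewrite eqE; apply: eq_bigr => j _; congr (_ * _ + _).
    by apply: eq_mon => // i /eE.
  by apply: eq_bigr => i _; congr (_ * _); apply: eq_dmon => // b /eE.
have y_neq1 j0 j : j != j0 -> chart_y x j s.+1 != chart_y x j0 s.+1 by apply: y_neq.
(* Meeting two tangent conditions takes two distinct points; with a single term, [dec] is already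
   the claim. *)
have [k_gt0|k_eq0] := ltnP 0 k; last first.
  have ord_eq (i j : 'I_n) : i = j.
    by apply: val_inj; have lti := ltn_ord i; have ltj := ltn_ord j; rewrite /=; lia.
  exists id => // l E; have := dec E.
  have sum1 (g : 'I_n -> F) : \sum_j g j = g l.
    by rewrite (big_pred1 l) // => j; rewrite (ord_eq j l) /= eqxx.
  by rewrite !sum1.
have ne01 : (ord0 : 'I_n) != ord_max by rewrite -val_eqE /= eq_sym -lt0n.
have span l : exists c : 'I_n -> F, forall E,
    tens s.+1 (v l) E = \sum_j c j * mon s.+1 (chart_y x j) E.
  have [c0 [d0 tan0]] := tan l ord0; have [c1 [d1 tan1]] := tan l ord_max.
  exists c0; apply: (tangent_meet ne01 (pairx _ _ ne01)).
    exact: tangent_contract (y_neq1 ord0) (but1x ord0) tan0.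
  exact: tangent_contract (y_neq1 ord_max) (but1x ord_max) tan1.
apply: perm_of_proportional => // l; have [c cE] := span l.
exact: tens_in_span cE.
Qed.

End GenericDecompositions.

(** * Projective points *)

Section Homogeneous.
Variables (F : numFieldType) (r : nat).
Implicit Types (q : {mpoly F[r]}) (w : 'I_r -> F).

Lemma meval_homog d q w t : q \is d.-homog -> q.@[fun i => t * w i] = t ^+ d * q.@[w].
Proof.
move=> /dhomogP q_homog; rewrite !mevalE mulr_sumr; apply: eq_big_seq => a /q_homog /= <-.
rewrite mulrCA; congr (_ * _); rewrite mdegE -prodrXr -big_split /=.
by apply: eq_bigr => i _; rewrite exprMn.
Qed.

Lemma meval_scale q w t :
  q.@[fun i => t * w i] = \sum_(d < msize q) (pihomog mdeg d q).@[w] * t ^+ d.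
Proof.
rewrite {1}(@pihomog_partitionE _ _ mdeg (msize q) q (leqnn _)) raddf_sum; apply: eq_bigr => d _.
by rewrite /= (@meval_homog d) ?pihomogP // mulrC.
Qed.

(** The value at [t * w] is a polynomial in [t] whose coefficients are the values of the homogeneous
    components at [w]. *)
Lemma pihomog_eq0 q w : (forall t, t != 0 -> q.@[fun i => t * w i] = 0) ->
  forall d, (pihomog mdeg d q).@[w] = 0.
Proof.
move=> q0 d; pose p := \poly_(d < msize q) (pihomog mdeg d q).@[w].
have p0 : p = 0 by apply: poly_eq0 => t /q0; rewrite horner_poly -meval_scale.
have [ltd|led] := ltnP d (msize q).
  by have := congr1 (fun p : {poly F} => p`_d) p0; rewrite coef_poly ltd coef0.
rewrite pihomogE big_seq_cond big_pred0 ?meval0 // => a.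
apply/negP => /andP[/msize_mdeg_lt lt_a /eqP a_d].
by move: lt_a; rewrite ltnNge a_d led.
Qed.

End Homogeneous.

Section Points.
Variables (F : fieldType) (r : nat).
Implicit Types (P Q : point F r).

Lemma line_eq P (u : 'rV[F]_r.+1) : u != 0 -> u \in line P -> line P = <[u]>%VS.
Proof.
move=> u_neq0 uP; apply/esym/eqP; rewrite eqEdim -memvE uP.
by rewrite (eqP (dim_line P)) dim_vline u_neq0.
Qed.

Lemma point_inj P Q : line P = line Q -> P = Q.
Proof. exact: val_inj. Qed.

Lemma linear_span_perm n (s t : n.-tuple (point F r)) :
  perm_eq s t -> linear_span s = linear_span t.
Proof.
move=> st; rewrite /linear_span.
rewrite -!(big_tuple _ _ _ xpredT (@line F r)).
exact: perm_big.
Qed.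

Lemma perm_eq_inj n (s t : n.-tuple (point F r)) (h : 'I_n -> 'I_n) : injective h ->
  (forall i, tnth t i = tnth s (h i)) -> perm_eq s t.
Proof.
move=> h_inj th; have -> : (t : seq _) = [seq tnth s i | i <- [seq h i | i <- enum 'I_n]].
  by rewrite -map_comp -[LHS]map_tnth_enum; apply: eq_map => i /=; rewrite th.
rewrite -{1}[s : seq _]map_tnth_enum perm_map //.
apply: uniq_perm => [||i]; [exact: enum_uniq | by rewrite map_inj_uniq // enum_uniq |].
rewrite mem_enum; symmetry; apply/mapP.
by exists (invF h_inj i); rewrite ?mem_enum ?f_invF.
Qed.

End Points.

(** * From tensors to secant spaces of the Segre variety *)

Section Segre.
Variables (F : numClosedFieldType) (k m' : nat).
Local Notation n := k.+1.
Local Notation m := m'.+1.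
Local Notation r := (2 ^ m - 1)%N.
Let V := ('I_n * 'I_m.+1)%type.
Let X : set (point F r) := segre_variety (F := F) (m := m).
Implicit Types (x : V -> F) (P : point F r) (u : 'rV[F]_r.+1).

Lemma tens_of_decomposition (t : n.-tuple (point F r)) u :
    (forall i, X (tnth t i)) -> u \in linear_span t ->
  exists v : 'I_n -> nat -> 'rV[F]_2, (forall e, u 0 e = \sum_l tens m (v l) (digit e)) /\
    forall l, \row_e tens m (v l) (digit e) \in line (tnth t l).
Proof.
move=> tX /memv_sumP[us us_t ->].
have term l : exists v : nat -> 'rV[F]_2, us l = \row_e tens m v (digit e).
  have [z _ zt] := tX l; have := us_t l isT; rewrite -zt => /vlineP[c ->].
  (* The scalar is absorbed into the last factor. *)
  exists (fun i => (if i == m' then c else 1) *: hcoord (z (inord i))).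
  apply/rowP => e; rewrite !mxE /tens !big_ord_recr /= mulrCA eqxx !mxE; congr (_ * (_ * _)).
  - apply: eq_bigr => i _; rewrite ltn_eqF // scale1r.
    by congr (hcoord (z _) _ _); apply: val_inj; rewrite /= inordK // ltnS ltnW.
  - by congr (hcoord (z _) _ _); apply: val_inj; rewrite /= inordK.
have [v vE] := choice term; exists v; split=> [e|l]; last by rewrite -vE us_t.
by rewrite summxE; apply: eq_bigr => l _; rewrite vE mxE.
Qed.

Definition affine_pt (c : F) : 'rV[F]_2 := \row_b (if b == 0 then 1 else c).

Lemma affine_pt_neq0 c : affine_pt c != 0.
Proof. by apply/rV0Pn; exists 0; rewrite mxE oner_eq0. Qed.

Definition chart_point x (j : 'I_n) : point F r :=
  segre [ffun i : 'I_m => point_of (affine_pt_neq0 (chart_y x j i))].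

Lemma segre_chart_point x j : X (chart_point x j).
Proof. by exists [ffun i : 'I_m => point_of (affine_pt_neq0 (chart_y x j i))]. Qed.

Definition chart_term x (j : 'I_n) : 'rV[F]_r.+1 := \row_e mon m (chart_y x j) (digit e).

Lemma line_chart_point x j : line (chart_point x j) = <[chart_term x j]>%VS.
Proof.
rewrite (@line_segre _ _ _ (fun i => affine_pt (chart_y x j i))) => [|i]; last by rewrite ffunE.
congr <[_]>%VS; apply/rowP => e; rewrite !mxE; apply: eq_bigr => i _; rewrite mxE.
rewrite -val_eqE /= /bit -/(digit e i) inordK; by case: (digit e i).
Qed.

Definition chart_vec x : 'rV[F]_r.+1 := \row_e chart e x.

Lemma chart_vecE x : chart_vec x = \sum_j chart_a x j *: chart_term x j.
Proof. by apply/rowP => e; rewrite mxE summxE; apply: eq_bigr => j _; rewrite !mxE. Qed.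

Section GoodParameters.
Variable x : V -> F.
Hypothesis a_neq0 : forall j, chart_a x j != 0.
Hypothesis mon_free : forall c : 'I_n -> F,
  (forall E, \sum_j c j * mon m (chart_y x j) E = 0) -> forall j, c j = 0.
Hypothesis unique_tens : forall v : 'I_n -> nat -> 'rV[F]_2,
  (forall e, chart e x = \sum_l tens m (v l) (digit e)) ->
  exists2 h : 'I_n -> 'I_n, injective h &
    forall l E, tens m (v l) E = chart_a x (h l) * mon m (chart_y x (h l)) E.

Let s : n.-tuple (point F r) := [tuple chart_point x j | j < n].

Lemma chart_term_free (c : 'I_n -> F) :
  \sum_j c j *: chart_term x j = 0 -> forall j, c j = 0.
Proof.
move=> c0; apply: mon_free => E; have [e eE] := digit_surj m E.
have /rowP/(_ e) := c0; rewrite summxE mxE => c0e; rewrite -[RHS]c0e.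
apply: eq_bigr => j _; rewrite !mxE; congr (_ * _).
by apply: eq_mon => // i /eE.
Qed.

Lemma chart_term_neq0 j : chart_term x j != 0.
Proof.
apply/eqP => term0; pose c i : F := (i == j)%:R.
suff c0 : \sum_i c i *: chart_term x i = 0.
  by have /eqP := chart_term_free c0 j; rewrite /c eqxx oner_eq0.
rewrite (bigD1 j) //= term0 scaler0 add0r big1 // => i /negPf ne_ij.
by rewrite /c ne_ij scale0r.
Qed.

Lemma chart_lin_indep : lin_indep s.
Proof.
apply/directv_sum_independent => us us_s us0 i _.
have c_us j : exists c, us j = c *: chart_term x j.
  by apply/vlineP; rewrite -line_chart_point -[chart_point x j](tnth_mktuple (chart_point x)) us_s.
have [c cE] := choice c_us; rewrite cE (chart_term_free (c := c)) ?scale0r // -[RHS]us0.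
by apply: eq_bigr => j _; rewrite cE.
Qed.

Lemma chart_vec_in_span : chart_vec x \in linear_span s.
Proof.
rewrite chart_vecE; apply: memv_suml => j _; apply/memvZ/(subvP (sumv_sup j isT (subvv _))).
by rewrite tnth_mktuple line_chart_point memv_line.
Qed.

Lemma chart_secant_space : secant_space X k (linear_span s).
Proof.
split.
  rewrite (directvP chart_lin_indep) /= (eq_bigr (fun=> 1%N)) => [|j _].
    by rewrite sum1_card card_ord.
  exact/eqP/dim_line.
exists s; split=> // [i|]; last exact: chart_lin_indep.
by rewrite tnth_mktuple; apply: segre_chart_point.
Qed.

Lemma chart_vec_neq0 : chart_vec x != 0.
Proof.
apply/eqP; rewrite chart_vecE => /chart_term_free/(_ ord0)/eqP.
by rewrite (negPf (a_neq0 _)).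
Qed.

Lemma chart_identifiable P : chart_vec x \in line P ->
  (exists! L, secant_space X k L /\ (line P <= L)%VS) /\ unique_decomposition X n P.
Proof.
move=> xP; have lineP := line_eq chart_vec_neq0 xP.
have sP : (line P <= linear_span s)%VS by rewrite lineP -memvE chart_vec_in_span.
have uniq_s (t : n.-tuple (point F r)) : decomposition X P t -> perm_eq s t.
  case=> tX tP; have [v [vE vt]] := tens_of_decomposition tX (subvP tP _ xP).
  have [|h h_inj hE] := unique_tens (v := v) => [e|]; first by rewrite -vE mxE.
  apply: perm_eq_inj h_inj _ => l; apply: point_inj; rewrite tnth_mktuple line_chart_point.
  have term_l : \row_e tens m (v l) (digit e) = chart_a x (h l) *: chart_term x (h l).
    by apply/rowP => e; rewrite !mxE hE.
  apply: line_eq (chart_term_neq0 _) _.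
  have := vt l; rewrite term_l => /(memvZ (chart_a x (h l))^-1).
  by rewrite scalerA mulVf // scale1r.
split.
  exists (linear_span s); split; first by split=> //; apply: chart_secant_space.
  move=> L [[_ [t [tX _ ->]]] tP].
  exact/linear_span_perm/uniq_s.
exists s => //; split=> // i.
by rewrite tnth_mktuple; apply: segre_chart_point.
Qed.

End GoodParameters.

Let secants : set (point F r) := [set P | exists2 L, secant_space X k L & (line P <= L)%VS]%classic.

Lemma in_closure_secant P u : secants P -> u \in line P -> in_closure (@chart F n m) (u 0).
Proof.
case=> _ [_ [t [tX _ ->]]] Pt uP q q0.
have [v [vE _]] := tens_of_decomposition tX (subvP Pt _ uP).
by rewrite -[RHS](in_closure_tens v q0); apply: meval_eq => e.
Qed.

Lemma chart_scale x c : exists x', forall e, chart e x' = c * chart e x.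
Proof.
exists (fun v => if v.2 == ord_max then c * x v else x v) => e.
rewrite mulr_sumr; apply: eq_bigr => j _; rewrite /chart_a /= eqxx mulrA; congr (_ * _).
apply: eq_mon => // i ltim; rewrite /chart_y /= -val_eqE /= inordK ?ltn_eqF //.
by rewrite ltnS ltnW.
Qed.

(** Scaling the coefficients of the points shows that the image of [chart] is a cone, so its ideal
    is homogeneous. *)
Lemma vanishes_pihomog q d :
  vanishes (@chart F n m) q -> vanishes (@chart F n m) (pihomog mdeg d q).
Proof.
move=> q0 x; apply: pihomog_eq0 => c _; have [x' x'E] := chart_scale x c.
by rewrite -[RHS](q0 x'); apply: meval_eq => e; rewrite x'E.
Qed.

(** Each homogeneous component of [q] defines a closed set containing all the secant spaces, hence
    the secant variety. *)
Lemma in_closure_secant_variety P u :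
  secant_variety X k P -> u \in line P -> in_closure (@chart F n m) (u 0).
Proof.
move=> PS uP q q0; rewrite (@pihomog_partitionE _ _ mdeg (msize q) q (leqnn _)).
rewrite raddf_sum big1 // => d _ /=.
have closedZ : zariski_closed (zero_locus [set pihomog mdeg d q]%classic : set (point F r)).
  by exists [set pihomog mdeg d q]%classic; split=> // _ ->; exists d; apply: pihomogP.
apply: (PS _ closedZ _ _ (erefl _) u uP) => Q QA _ -> v vQ.
exact: in_closure_secant QA vQ _ (vanishes_pihomog _ q0).
Qed.

Lemma sub_secant_variety P : secants P -> secant_variety X k P.
Proof. by move=> PA Z _; apply. Qed.

End Segre.

(** * Identifiability off a proper closed subset of the secant variety *)

Theorem segre_identifiable (F : numClosedFieldType) (s k : nat) :
    (3 < s)%N -> (k.+1 * s.+2 <= 2 ^ s.+1)%N ->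
  let X := segre_variety (F := F) (m := s.+2) in
  general (secant_variety X k)
    (fun P => (exists! L, secant_space X k L /\ (line P <= L)%VS)
              /\ unique_decomposition X k.+1 P).
Proof.
move=> s_gt3 small_rank X; set r := (2 ^ s.+2 - 1)%N in X *.
have [g gP [g_neq0 goodP]] := generic_unique_decomposition F s_gt3 small_rank.
have chP e := @polyfun_chart F k.+1 s.+2 e.
have [h h_neq0 hP] := generic_preimage chP gP g_neq0.
(* The excluded set is the locus in the secant variety where all homogeneous components of [h]
   vanish; the first alternative keeps it inside the secant variety. *)
pose ideal : set {mpoly F[r.+1]} := [set q | (exists d, q \is d.-homog) /\
  ((forall P, secant_variety X k P -> forall v, v \in line P -> q.@[v 0] = 0) \/
   exists d, q = pihomog mdeg d h)]%classic.
have hd_ideal d : ideal (pihomog mdeg d h).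
  by split; [exists d; apply: pihomogP | right; exists d].
exists (zero_locus ideal); split.
- by exists ideal; split=> // q [].
- split.
    move=> P PZ _ [I [I_homog ->]] AI q Iq v vP.
    apply: PZ vP; split; first exact: I_homog.
    left=> Q QS w wQ; apply: (QS (zero_locus I)) wQ => //.
    by exists I.
  (* The excluded set is proper: a good parameter where the pullback of [h] is nonzero gives a point
     of the secant variety outside it. *)
  have [x] := polyfun_neq0 (polyfun_meval h chP) gP h_neq0 g_neq0.
  rewrite mulf_eq0 => /norP[hx /goodP[a_neq0 mon_free uniq_x]].
  have x_neq0 := chart_vec_neq0 a_neq0 mon_free.
  pose P := point_of x_neq0; move/(_ P) => sub.
  have PZ : zero_locus ideal P.
    apply: sub; apply: sub_secant_variety; exists (linear_span [tuple chart_point x j | j < k.+1]).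
      exact: chart_secant_space.
    by rewrite -memvE chart_vec_in_span.
  case/eqP: hx; rewrite (@pihomog_partitionE _ _ mdeg (msize h) h (leqnn _)).
  rewrite raddf_sum big1 // => d _ /=.
  have := PZ _ (hd_ideal d) (chart_vec x) (memv_line _); apply: etrans.
  by apply: meval_eq => e; rewrite mxE.
move=> P PS PZ.
have [d [u uP hdu]] : exists d, exists2 u, u \in line P & (pihomog mdeg d h).@[u 0] != 0.
  apply: contrapT => no; apply: PZ => q [_ [q0|[d ->]]] v vP; first exact: q0 vP.
  by apply/eqP/contraT => nz; case: no; exists d, v.
(* [h] need not be homogeneous, but a component that is nonzero at [u] makes [h] nonzero at some
   multiple of [u]. *)
have [c hcu] : exists c, h.@[fun i => c * u 0 i] != 0.
  apply: contrapT => no; case/eqP: hdu; apply: pihomog_eq0 => c _.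
  by apply/eqP/contraT => nz; case: no; exists c.
have cuP : c *: u \in line P by apply: memvZ.
have cuE : (c *: u) 0 = (fun i => c * u 0 i) by apply/funext => i; rewrite mxE.
(* This multiple lies in the closure of the image of [chart] and off the zeros of [h], so it comes
   from a good parameter. *)
have [||x /goodP[a_neq0 mon_free uniq_x] xE] := hP ((c *: u) 0).
- exact: in_closure_secant_variety PS cuP.
- by rewrite cuE.
apply: (chart_identifiable a_neq0 mon_free uniq_x).
by rewrite (_ : chart_vec x = c *: u) //; apply/rowP => e; rewrite mxE xE.
Qed.

Theorem theorem1p1 (R : realType) (m k : nat) :
  (5 < m)%N ->
  (k.+1%:R <= 2%:R ^+ (m - 1) / m%:R :> rat)%R ->
  let X := segre_variety (F := complex R) (m := m) in
  general (secant_variety X k)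
    (fun P => (exists! L, secant_space X k L /\ (line P <= L)%VS)
              /\ unique_decomposition X k.+1 P).
Proof.
case: m => [|[|s]] // s_gt3; rewrite ler_pdivlMr ?ltr0n // -natrX -natrM ler_nat subn1 /=.
move=> small_rank; exact: segre_identifiable.
Qed.
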